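(* There exist numerical constants $c,c'>0$ such that for all $p\in\mathbb{N}_+$, $\Delta>0$, $L_0,L_1,\dots,L_{p+1}>0$, $\mu\in(0,L_1]$, $\sigma>0$ and $\epsilon\le c\sqrt{L_1\Delta}$, there exist a distribution over instances $(f,g)\in\mathcal{F}^{\text{nc-sc}}(L_0,\dots,L_{p+1},\mu,\Delta)$ (in some dimension) together with stochastic gradient estimators $F,G$ of variance at most $\sigma^2$, such that for every randomized algorithm $\mathtt{A}$ of the form below, $\mathbb{E}\|\nabla\varphi(\mathbf{x}_t)\|>\epsilon$ for all $t< c'\Delta L_1\sigma^2\epsilon^{-4}$, where the expectation is over the instance, the oracle randomness and the algorithm's randomness. In particular, finding an $\epsilon$-stationary point of $\varphi$ requires $\Omega(\Delta L_1\sigma^2\epsilon^{-4})$ stochastic gradient oracle calls.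
   Context: Bilevel problem: $f,g:\mathbb{R}^{d_x}\times\mathbb{R}^{d_y}\to\mathbb{R}$, $\mathbf{y}^*(\mathbf{x})=\arg\min_{\mathbf{y}}g(\mathbf{x},\mathbf{y})$, hyper-objective $\varphi(\mathbf{x})=f(\mathbf{x},\mathbf{y}^*(\mathbf{x}))$. The class $\mathcal{F}^{\text{nc-sc}}(L_0,\dots,L_{p+1},\mu,\Delta)$ (with $\Delta>0$, $L_0,\dots,L_{p+1}>0$, $0<\mu\le L_1$) consists of all pairs $(f,g)$ such that: (i) $\varphi(\mathbf{0})-\inf_{\mathbf{x}}\varphi(\mathbf{x})\le\Delta$; (ii) $g(\mathbf{x},\cdot)$ is $\mu$-strongly convex for every $\mathbf{x}$; (iii) $f(\mathbf{x},\cdot)$ is $L_0$-Lipschitz; $\nabla f$ and $\nabla g$ are $L_1$-Lipschitz jointly in $(\mathbf{x},\mathbf{y})$; $\nabla^2_{xy}g$ and $\nabla^2_{yy}g$ are $L_2$-Lipschitz jointly in $(\mathbf{x},\mathbf{y})$; (iv) for $q=1,\dots,p-1$, $\frac{\partial^q}{\partial\mathbf{y}^q}\nabla f(\mathbf{x},\mathbf{y})$ is $L_{q+1}$-Lipschitz and $\frac{\partial^{q+1}}{\partial\mathbf{y}^{q+1}}\nabla g(\mathbf{x},\mathbf{y})$ is $L_{q+2}$-Lipschitz in $\mathbf{y}$. Stochastic oracles: $F(\mathbf{x},\mathbf{y})$ and $G(\mathbf{x},\mathbf{y})$ are random vectors with $\mathbb{E}F=\nabla f$, $\mathbb{E}G=\nabla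 g$, $\mathbb{E}\|F-\nabla f\|^2\le\sigma^2$, $\mathbb{E}\|G-\nabla g\|^2\le\sigma^2$, independent across queries. A randomized algorithm $\mathtt{A}$ consists of a random seed $r$ drawn once at the start and measurable maps $\mathtt{A}_t$ with $(\mathbf{x}_0,\mathbf{y}_0)=(\mathbf{0},\mathbf{0})$ and $(\mathbf{x}_{t+1},\mathbf{y}_{t+1})=\mathtt{A}_t\big(r,F(\mathbf{x}_0,\mathbf{y}_0),G(\mathbf{x}_0,\mathbf{y}_0),\dots,F(\mathbf{x}_t,\mathbf{y}_t),G(\mathbf{x}_t,\mathbf{y}_t)\big)$. A point $\mathbf{x}$ is $\epsilon$-stationary if $\|\nabla\varphi(\mathbf{x})\|\le\epsilon$. *)

(* Defs.v *)
From HB Require Import structures.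
From mathcomp Require Import all_boot all_order all_algebra.
From mathcomp Require Import all_classical all_reals all_analysis.
Set Implicit Arguments. Unset Strict Implicit. Unset Printing Implicit Defensive.
Import Order.TTheory GRing.Theory Num.Theory.
Import numFieldNormedType.Exports.
Local Open Scope classical_set_scope.
Local Open Scope ring_scope.

Section Bilevel.
Variable R : realType.

(* Euclidean norm on R^n (rows); MathComp's built-in matrix norm is the sup norm. *)
Definition enorm (n : nat) (v : 'rV[R]_n) : R := Num.sqrt (\sum_i v 0 i ^+ 2).

(* gradient: vector of partial derivatives (meaningful when f is differentiable) *)
Definition grad (n : nat) (f : 'rV[R]_n -> R) (z : 'rV[R]_n) : 'rV[R]_n :=
  \row_i ('D_(delta_mx 0 i) f z).

(* points of R^{dx} x R^{dy} are encoded as the concatenation row_mx x y *)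
Section Dims.
Variables dx dy : nat.
Local Notation N := (dx + dy)%N.

(* y*(x) = argmin_y g(x, y) (unique under strong convexity) *)
Definition ystar (g : 'rV[R]_N -> R) (x : 'rV[R]_dx) : 'rV[R]_dy :=
  xget 0 [set y | forall y', g (row_mx x y) <= g (row_mx x y')].

Definition phi (f g : 'rV[R]_N -> R) (x : 'rV[R]_dx) : R := f (row_mx x (ystar g x)).

(* iterated partial derivatives in y of a vector field h, in directions vs:
   Dy h x [:: v1; ...; vq] y = (d^q/dy^q h(x, y))[v1, ..., vq] *)
Fixpoint Dy (m : nat) (h : 'rV[R]_N -> 'rV[R]_m) (x : 'rV[R]_dx)
    (vs : seq 'rV[R]_dy) (y : 'rV[R]_dy) : 'rV[R]_m :=
  match vs with
  | [::] => h (row_mx x y)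
  | v :: vs' => 'D_v (Dy h x vs') y
  end.

Definition Hxy (g : 'rV[R]_N -> R) (x : 'rV[R]_dx) (y v : 'rV[R]_dy) : 'rV[R]_dx :=
  lsubmx ('D_v (fun y' => grad g (row_mx x y')) y).
Definition Hyy (g : 'rV[R]_N -> R) (x : 'rV[R]_dx) (y v : 'rV[R]_dy) : 'rV[R]_dy :=
  rsubmx ('D_v (fun y' => grad g (row_mx x y')) y).

Definition ydiff (h : 'rV[R]_N -> 'rV[R]_N) (m : nat) : Prop :=
  forall x (vs : seq 'rV[R]_dy) y, (size vs < m)%N -> differentiable (Dy h x vs) y.

(* the q-th y-derivative of h (a q-linear map) is L-Lipschitz in y (operator norm) *)
Definition ylip (h : 'rV[R]_N -> 'rV[R]_N) (q : nat) (L : R) : Prop :=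
  forall x (vs : seq 'rV[R]_dy) y y', size vs = q ->
    enorm (Dy h x vs y - Dy h x vs y') <= L * enorm (y - y') * \prod_(v <- vs) enorm v.

Definition in_class (p : nat) (L : nat -> R) (mu Delta : R) (f g : 'rV[R]_N -> R) : Prop :=
  (forall x, phi f g 0 - phi f g x <= Delta) /\
  (forall x y y' (t : R), 0 <= t <= 1 ->
     g (row_mx x (t *: y + (1 - t) *: y')) <=
       t * g (row_mx x y) + (1 - t) * g (row_mx x y')
       - mu / 2 * t * (1 - t) * enorm (y - y') ^+ 2) /\
  (forall x y y', `|f (row_mx x y) - f (row_mx x y')| <= L 0%N * enorm (y - y')) /\
  (forall z, differentiable f z) /\ (forall z, differentiable g z) /\
  (forall z z', enorm (grad f z - grad f z') <= L 1%N * enorm (z - z')) /\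
  (forall z z', enorm (grad g z - grad g z') <= L 1%N * enorm (z - z')) /\
  ydiff (grad g) 1 /\
  (forall x y x' y' v, enorm (Hxy g x y v - Hxy g x' y' v)
      <= L 2%N * enorm (row_mx x y - row_mx x' y') * enorm v) /\
  (forall x y x' y' v, enorm (Hyy g x y v - Hyy g x' y' v)
      <= L 2%N * enorm (row_mx x y - row_mx x' y') * enorm v) /\
  ydiff (grad f) p.-1 /\ ydiff (grad g) p /\
  (forall q, (1 <= q <= p.-1)%N ->
     ylip (grad f) q (L q.+1) /\ ylip (grad g) q.+1 (L q.+2)).

(* conversions between rows and tuples (tuples carry the product sigma-algebra) *)
Definition r2t (n : nat) (v : 'rV[R]_n) : n.-tuple R := [tuple v 0 i | i < n].
Definition t2r (n : nat) (t : n.-tuple R) : 'rV[R]_n := \row_i tnth t i.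

Definition Pt := (dx.-tuple R * dy.-tuple R)%type.
Definition Obs := (N.-tuple R * N.-tuple R)%type.
Definition zero_pt : Pt := ([tuple 0 | i < dx], [tuple 0 | i < dy]).
Definition row_of_pt (z : Pt) : 'rV[R]_N := row_mx (t2r z.1) (t2r z.2).

(* randomized algorithm with seed space S: A t (r, [F(z_0),G(z_0),...,F(z_t),G(z_t)]) = z_{t+1} *)
Definition algo (S : Type) := forall t : nat, (S * (t.+1).-tuple Obs)%type -> Pt.

Definition pt_at (S : Type) (A : algo S) (r : S) (k : nat) : k.-tuple Obs -> Pt :=
  match k with
  | 0 => fun _ => zero_pt
  | k'.+1 => fun h => A k' (r, h)
  end.

(* Expectation over the oracle noise of |grad phi(x_{k+m})|, given seed r and the
   history h of the first k oracle answers. Each query z_j receives the answer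
   (F(z_j, xi_j), G(z_j, xi_j)) with a fresh xi_j ~ Pxi, independent of everything else. *)
Fixpoint EV (dxi : measure_display) (Xi : measurableType dxi) (Pxi : probability Xi R)
    (f g : 'rV[R]_N -> R) (Fo Go : 'rV[R]_N -> Xi -> 'rV[R]_N)
    (S : Type) (A : algo S) (r : S) (m k : nat) (h : k.-tuple Obs) : \bar R :=
  let z := pt_at A r h in
  match m with
  | 0 => (enorm (grad (phi f g) (t2r z.1)))%:E
  | m'.+1 => (\int[Pxi]_xi
      EV Pxi f g Fo Go A r m'
        [tuple of rcons h (r2t (Fo (row_of_pt z) xi), r2t (Go (row_of_pt z) xi))])%E
  end.

Definition sgrad_oracle (dxi : measure_display) (Xi : measurableType dxi)
    (Pxi : probability Xi R) (f : 'rV[R]_N -> R) (Fo : 'rV[R]_N -> Xi -> 'rV[R]_N)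
    (sigma : R) : Prop :=
  forall z,
    (forall i, Pxi.-integrable setT (fun xi => (Fo z xi 0 i)%:E) /\
               (\int[Pxi]_xi (Fo z xi 0 i)%:E = (grad f z 0 i)%:E)%E) /\
    (\int[Pxi]_xi ((enorm (Fo z xi - grad f z)) ^+ 2)%:E <= (sigma ^+ 2)%:E)%E.

End Dims.
End Bilevel.

(* Main.v *)
(* The objective does not depend on y, so the problem reduces to the stochastic
   lower bound for smooth nonconvex functions. The variable x is cut into T blocks,
   the j-th of which hides a target 2 e_(th j), with th uniformly random; writing
   z_j for the offset of block j from its target, the objective is a rescaling of
     |x|^2 / 2 - sum_j Psi(z_(j-1)) Phi(z_j),
   where Psi and Phi are C^{1,1} bumps of radius 1 and 4 and the first factor is 1 for
   j = 0. As long as some block is not close to its target, the first such block has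
   gradient at least 1: the bump Phi attracts it from nearby, the quadratic term from
   far away. The radius-1 balls around the possible targets of a block are disjoint,
   so a query hits the still unknown target of a given block with probability at most
   1 / M, M being the number of candidates. The oracle hides the only link of the chain
   that would disclose a new target, and reveals it, multiplied by 1 / p, with
   probability p ~ eps^2 / sigma^2; hence T ~ Delta L_1 / eps^2 targets cost about
   T / p queries. *)
Require Import Defs.
From HB Require Import structures.
From mathcomp Require Import all_boot all_order all_algebra.
From mathcomp Require Import all_classical all_reals all_analysis measurable_realfun.
From mathcomp Require Import ring lra zify.
Import Order.TTheory GRing.Theory Num.Theory.
Import numFieldNormedType.Exports.
Local Open Scope classical_set_scope.
Local Open Scope ring_scope.

(** * Euclidean norm and bumps *)

Section Euclid.
Context {R : realType}.
Implicit Types n : nat.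

Definition dotp n (u v : 'rV[R]_n) : R := \sum_i u 0 i * v 0 i.

Lemma dotpDl n (u v w : 'rV[R]_n) : dotp n (u + v) w = dotp n u w + dotp n v w.
Proof. by rewrite /dotp -big_split; apply: eq_bigr => i _; rewrite mxE mulrDl. Qed.

Lemma dotpC n (u v : 'rV[R]_n) : dotp n u v = dotp n v u.
Proof. by apply: eq_bigr => i _; rewrite mulrC. Qed.

Lemma dotpZl n a (u v : 'rV[R]_n) : dotp n (a *: u) v = a * dotp n u v.
Proof. by rewrite /dotp mulr_sumr; apply: eq_bigr => i _; rewrite mxE mulrA. Qed.

Lemma dotpDr n (u v w : 'rV[R]_n) : dotp n u (v + w) = dotp n u v + dotp n u w.
Proof. by rewrite dotpC dotpDl !(dotpC _ u). Qed.

Lemma dotpZr n a (u v : 'rV[R]_n) : dotp n u (a *: v) = a * dotp n u v.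
Proof. by rewrite dotpC dotpZl dotpC. Qed.

Lemma dotpNl n (u v : 'rV[R]_n) : dotp n (- u) v = - dotp n u v.
Proof. by rewrite -scaleN1r dotpZl mulN1r. Qed.

Lemma dotpNr n (u v : 'rV[R]_n) : dotp n u (- v) = - dotp n u v.
Proof. by rewrite dotpC dotpNl dotpC. Qed.

Lemma dotp_delta n (u : 'rV[R]_n) i : dotp n u (delta_mx 0 i) = u 0 i.
Proof.
rewrite /dotp (bigD1 i) //= big1 => [|j ji]; rewrite mxE !eqxx/=.
  by rewrite mulr1 addr0.
by rewrite (negbTE ji) mulr0.
Qed.

Lemma dotp_ge0 n (u : 'rV[R]_n) : 0 <= dotp n u u.
Proof. by apply: sumr_ge0 => i _; rewrite -expr2 sqr_ge0. Qed.

Lemma enorm_ge0 n (u : 'rV[R]_n) : 0 <= enorm u.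
Proof. exact: sqrtr_ge0. Qed.

Lemma enormE n (u : 'rV[R]_n) : enorm u = Num.sqrt (dotp n u u).
Proof. by congr Num.sqrt; apply: eq_bigr => i _; rewrite expr2. Qed.

Lemma enorm_sq n (u : 'rV[R]_n) : enorm u ^+ 2 = dotp n u u.
Proof. by rewrite enormE sqr_sqrtr // dotp_ge0. Qed.

Lemma enorm_sqE n (u : 'rV[R]_n) : enorm u ^+ 2 = \sum_i u 0 i ^+ 2.
Proof. by rewrite enorm_sq; apply: eq_bigr => i _; rewrite expr2. Qed.

Lemma enorm_le n (u : 'rV[R]_n) (b : R) : 0 <= b -> enorm u ^+ 2 <= b ^+ 2 -> enorm u <= b.
Proof. by move=> b0; rewrite ler_sqr // nnegrE // enorm_ge0. Qed.

Lemma enorm0 n : enorm (0 : 'rV[R]_n) = 0.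
Proof. by rewrite enormE /dotp big1 ?sqrtr0 // => i _; rewrite mxE mul0r. Qed.

Lemma enormZ n a (u : 'rV[R]_n) : enorm (a *: u) = `|a| * enorm u.
Proof.
rewrite !enormE dotpZl dotpZr mulrA -expr2 sqrtrM ?sqr_ge0 //.
by rewrite sqrtr_sqr.
Qed.

Lemma enormN n (u : 'rV[R]_n) : enorm (- u) = enorm u.
Proof. by rewrite -scaleN1r enormZ normrN1 mul1r. Qed.

Lemma enormBC n (u v : 'rV[R]_n) : enorm (u - v) = enorm (v - u).
Proof. by rewrite -enormN opprB. Qed.

(** Cauchy-Schwarz, read off from the nonnegative square of [dotp v v *: u - dotp u v *: v]. *)
Lemma dotp_le n (u v : 'rV[R]_n) : dotp n u v <= enorm u * enorm v.
Proof.
have [v0|v0] := eqVneq (dotp n v v) 0.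
  suff -> : dotp n u v = 0 by rewrite mulr_ge0 // enorm_ge0.
  apply: big1 => i _; suff /eqP -> : v 0 i == 0 by rewrite mulr0.
  rewrite -sqrf_eq0 expr2; apply/eqP.
  by apply: (psumr_eq0P _ v0) => // j _; rewrite -expr2 sqr_ge0.
apply: le_trans (ler_norm _) _.
rewrite -ler_sqr ?nnegrE ?mulr_ge0 ?enorm_ge0 // exprMn real_normK ?num_real //.
rewrite !enorm_sq.
have vp : 0 < dotp n v v by rewrite lt_def v0 dotp_ge0.
have := dotp_ge0 n (dotp n v v *: u - dotp n u v *: v).
rewrite dotpDl !dotpDr !dotpNl !dotpNr !dotpZl !dotpZr (dotpC _ v u) => h.
rewrite -(ler_pM2l vp); nra.
Qed.

Lemma enormD n (u v : 'rV[R]_n) : enorm (u + v) <= enorm u + enorm v.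
Proof.
apply: enorm_le; first by rewrite addr_ge0 ?enorm_ge0.
rewrite enorm_sq dotpDl !dotpDr sqrrD !enorm_sq (dotpC _ v u) mulr2n.
have := dotp_le _ u v; lra.
Qed.

Lemma enormB n (u v : 'rV[R]_n) : enorm (u - v) <= enorm u + enorm v.
Proof. by rewrite -(enormN _ v) enormD. Qed.

Lemma enorm_distD n (u v : 'rV[R]_n) : `|enorm u - enorm v| <= enorm (u - v).
Proof.
have h1 := enormD _ (u - v) v; have h2 := enormD _ (v - u) u.
rewrite !subrK in h1 h2; rewrite (enormBC _ v u) in h2.
by rewrite ler_norml; lra.
Qed.

Lemma enorm_coord n (u : 'rV[R]_n) i : `|u 0 i| <= enorm u.
Proof.
rewrite -ler_sqr ?nnegrE ?enorm_ge0 // real_normK ?num_real // enorm_sqE.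
by rewrite (bigD1 i) //= lerDl sumr_ge0 // => j _; rewrite sqr_ge0.
Qed.

Lemma enorm_delta n i : enorm (delta_mx 0 i : 'rV[R]_n) = 1.
Proof. by rewrite enormE dotp_delta mxE !eqxx sqrtr1. Qed.

Lemma dotp_row_mx n m (u u' : 'rV[R]_n) (v v' : 'rV[R]_m) :
  dotp _ (row_mx u v) (row_mx u' v') = dotp _ u u' + dotp _ v v'.
Proof.
rewrite /dotp big_split_ord /=; congr (_ + _); apply: eq_bigr => i _.
  by rewrite !row_mxEl.
by rewrite !row_mxEr.
Qed.

Lemma enorm_row_mx0 n m (u : 'rV[R]_n) : enorm (row_mx u (0 : 'rV[R]_m)) = enorm u.
Proof.
rewrite !enormE dotp_row_mx; congr Num.sqrt.
by rewrite -[X in _ + X]enorm_sq enorm0 expr0n addr0.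
Qed.

Lemma enorm_row_0mx n m (u : 'rV[R]_n) : enorm (row_mx (0 : 'rV[R]_m) u) = enorm u.
Proof.
rewrite !enormE dotp_row_mx; congr Num.sqrt.
by rewrite -[X in X + _]enorm_sq enorm0 expr0n add0r.
Qed.

Lemma enorm_lsubmx n m (z : 'rV[R]_(n + m)) : enorm (lsubmx z) <= enorm z.
Proof.
rewrite -[z in leRHS]hsubmxK !enormE dotp_row_mx ler_wsqrtr // lerDl.
exact: dotp_ge0.
Qed.

Lemma enorm_rsubmx n m (z : 'rV[R]_(n + m)) : enorm (rsubmx z) <= enorm z.
Proof.
rewrite -[z in leRHS]hsubmxK !enormE dotp_row_mx ler_wsqrtr // lerDr.
exact: dotp_ge0.
Qed.

End Euclid.
Arguments dotp {R n}.

(** * Compactly supported C^{1,1} bumps *)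

Section Bump.
Context {R : realType}.

Definition dip (rho r : R) : R := Num.max 0 (rho ^+ 2 - r ^+ 2).

Lemma dip_ge0 rho r : 0 <= dip rho r.
Proof. by rewrite /dip le_max lexx. Qed.

Lemma dip_le rho r : dip rho r <= rho ^+ 2.
Proof. by rewrite /dip ge_max sqr_ge0 gerBl sqr_ge0. Qed.

Lemma dip_eq0 rho r : 0 <= rho -> rho <= r -> dip rho r = 0.
Proof. by move=> h1 h2; apply/max_idPl; rewrite subr_le0; nra. Qed.

Lemma dip_lip rho r s : 0 <= rho -> 0 <= r -> 0 <= s ->
  `|dip rho r - dip rho s| <= 2 * rho * `|r - s|.
Proof.
wlog rs : r s / r <= s => [hw|] rho0 r0 s0.
  by case/orP: (le_total r s) => ?; [|rewrite distrC (distrC r)]; exact: hw.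
rewrite (distrC r) (ger0_norm (_ : 0 <= s - r)) ?subr_ge0 // /dip.
have [h1|h1] := leP 0 (rho ^+ 2 - r ^+ 2); have [h2|h2] := leP 0 (rho ^+ 2 - s ^+ 2).
- rewrite ger0_norm; last by nra.
  have : s <= rho by nra.
  nra.
- rewrite subr0 ger0_norm //.
  have : rho < s by nra.
  have : r <= rho by nra.
  nra.
- exfalso; nra.
- by rewrite subr0 normr0 mulr_ge0 ?subr_ge0 // mulr_ge0.
Qed.

(** The positive part of rho^2 - |z|^2 is squared so that the gradient stays Lipschitz across the
    sphere of radius rho. Only the squared norm enters, so the origin is no singularity. *)
Definition bump n (rho : R) (z : 'rV[R]_n) : R := dip rho (enorm z) ^+ 2.
Definition dbump n (rho : R) (z : 'rV[R]_n) : 'rV[R]_n :=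
  - ((4 * dip rho (enorm z)) *: z).

Variables (n : nat) (rho : R).
Hypothesis rho0 : 0 <= rho.
Implicit Types z w : 'rV[R]_n.

Lemma bump_ge0 z : 0 <= bump n rho z. Proof. exact: sqr_ge0. Qed.

Lemma bump_le z : bump n rho z <= rho ^+ 4.
Proof.
rewrite /bump (_ : rho ^+ 4 = (rho ^+ 2) ^+ 2); last by ring.
by rewrite lerXn2r ?nnegrE ?dip_ge0 ?sqr_ge0 // dip_le.
Qed.

Lemma bump_eq0 z : rho <= enorm z -> bump n rho z = 0.
Proof. by move=> h; rewrite /bump dip_eq0 // expr0n. Qed.

Lemma dbump_eq0 z : rho <= enorm z -> dbump n rho z = 0.
Proof. by move=> h; rewrite /dbump dip_eq0 // mulr0 scale0r oppr0. Qed.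

Lemma dip_enorm_lip z w :
  `|dip rho (enorm z) - dip rho (enorm w)| <= 2 * rho * enorm (z - w).
Proof.
apply: le_trans (dip_lip _ _ _ rho0 (enorm_ge0 _ _) (enorm_ge0 _ _)) _.
by rewrite ler_wpM2l ?mulr_ge0 // enorm_distD.
Qed.

Lemma bump_lip z w : `|bump n rho z - bump n rho w| <= 4 * rho ^+ 3 * enorm (z - w).
Proof.
rewrite /bump subr_sqr normrM.
have h1 := dip_enorm_lip z w.
have h2 : `|dip rho (enorm z) + dip rho (enorm w)| <= 2 * rho ^+ 2.
  rewrite ger0_norm ?addr_ge0 ?dip_ge0 //.
  have := dip_le rho (enorm z); have := dip_le rho (enorm w); lra.
apply: le_trans (ler_pM (normr_ge0 _) (normr_ge0 _) h1 h2) _.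
by rewrite le_eqVlt; apply/predU1P; left; ring.
Qed.

Lemma dbump_le z : enorm (dbump n rho z) <= 4 * rho ^+ 3.
Proof.
have [h|h] := leP rho (enorm z).
  by rewrite dbump_eq0 // enorm0 mulr_ge0 // exprn_ge0.
rewrite /dbump enormN enormZ ger0_norm ?mulr_ge0 ?dip_ge0 //.
rewrite (_ : 4 * rho ^+ 3 = (4 * rho ^+ 2) * rho); last by ring.
by rewrite ler_pM ?mulr_ge0 ?dip_ge0 ?enorm_ge0 // ?ler_wpM2l ?dip_le // ltW.
Qed.

Lemma dbump_lip z w :
  enorm (dbump n rho z - dbump n rho w) <= 12 * rho ^+ 2 * enorm (z - w).
Proof.
(* If both points lie outside the ball, both gradients vanish. Otherwise symmetry puts w inside, and
   |w| <= rho controls the term [(p - q) *: w] below; the two terms contribute 4 rho^2 and 8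
   rho^2. *)
wlog hw : z w / enorm w <= rho => [hwlog|].
  have [?|hw] := leP (enorm w) rho; first exact: hwlog.
  have [?|hz] := leP (enorm z) rho.
    by rewrite enormBC (enormBC _ z); exact: hwlog.
  rewrite !dbump_eq0 ?(ltW hw) ?(ltW hz) // subrr enorm0.
  by rewrite mulr_ge0 ?enorm_ge0 // mulr_ge0 // sqr_ge0.
set p := dip rho (enorm z); set q := dip rho (enorm w).
have -> : dbump n rho z - dbump n rho w = - ((4 * p) *: (z - w) + (4 * (p - q)) *: w).
  by apply/rowP => i; rewrite /dbump -/p -/q !mxE; ring.
rewrite enormN; apply: le_trans (enormD _ _ _) _; rewrite !enormZ !normrM.
rewrite (ger0_norm (dip_ge0 _ _)) (ger0_norm (_ : 0 <= 4)) //.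
have h1 : p <= rho ^+ 2 := dip_le _ _.
have h2 : `|p - q| <= 2 * rho * enorm (z - w) := dip_enorm_lip z w.
have h3 := enorm_ge0 _ (z - w).
have h4 : `|p - q| * enorm w <= 2 * rho * enorm (z - w) * rho.
  by rewrite ler_pM ?enorm_ge0.
have h5 : p * enorm (z - w) <= rho ^+ 2 * enorm (z - w) by rewrite ler_wpM2r.
rewrite -/p; nra.
Qed.

End Bump.

(** * Gradients *)

Section Gradient.
Context {R : realType}.

Lemma linear_rV_continuous n (W : normedModType R) (f : {linear 'rV[R]_n -> W}) :
  continuous f.
Proof.
apply/linear_bounded_continuous/linear_boundedP.
near=> r => x; rewrite [in leLHS](row_sum_delta x) linear_sum.
apply: le_trans (ler_norm_sum _ _ _) _.
apply: (@le_trans _ _ ((\sum_i `|f (delta_mx 0 i)|) * `|x|)); last first.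
  by rewrite ler_wpM2r //; near: r; exact: nbhs_pinfty_ge.
rewrite mulr_suml; apply: ler_sum => i _.
rewrite linearZ normrZ mulrC ler_wpM2l //.
rewrite {2}/Num.norm /= mx_normrE.
exact: (le_bigmax _ (fun ij : 'I_1 * 'I_n => `|x ij.1 ij.2|) (0, i)).
Unshelve. all: by end_near. Qed.

Lemma derive_linear (K : numFieldType) (V W : normedModType K) (f : {linear V -> W}) (x v : V) :
  'D_v f x = f v.
Proof.
apply/lim_near_cst => //=; near=> h.
rewrite /= [f _]linearD linearZ addrK scalerA mulVf ?scale1r //.
by near: h; exact: nbhs_dnbhs_neq.
Unshelve. all: by end_near. Qed.

Lemma derive_const (V W : normedModType R) (c : W) (x v : V) :
  'D_v (fun=> c) x = 0.
Proof. exact: derive_cst. Qed.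

Lemma is_diff_linear n (W : normedModType R) (f : {linear 'rV[R]_n -> W}) x :
  is_diff x f f.
Proof.
have cf := @linear_rV_continuous n W f.
by apply: DiffDef; [exact: linear_differentiable|exact: diff_lin].
Qed.

(** Differentiability and the gradient vector travel together, so that the rules for [is_diff]
    deliver gradients in closed form. *)
Definition hasgrad n (f : 'rV[R]_n -> R) (x G : 'rV[R]_n) : Prop := is_diff x f (dotp G).

Lemma hasgrad_differentiable n f (x G : 'rV[R]_n) : hasgrad n f x G -> differentiable f x.
Proof. by case. Qed.

Lemma hasgrad_grad n f (x G : 'rV[R]_n) : hasgrad n f x G -> grad f x = G.
Proof.
case=> df fE; apply/rowP => i; rewrite mxE deriveE // fE.
exact: dotp_delta.
Qed.

Section Closure.
Variable n : nat.
Implicit Types (f g : 'rV[R]_n -> R) (x G : 'rV[R]_n).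

Lemma hasgrad_eq f x G G' : hasgrad n f x G -> G = G' -> hasgrad n f x G'.
Proof. by move=> + <-. Qed.

Lemma hasgrad_cst (c : R) x : hasgrad n (fun=> c) x 0.
Proof.
apply: (is_diff_eq (is_diff_cst _ _)); apply/funext => h /=.
by rewrite /dotp big1 // => i _; rewrite mxE mul0r.
Qed.

Lemma hasgradD f g x F G :
  hasgrad n f x F -> hasgrad n g x G -> hasgrad n (fun y => f y + g y) x (F + G).
Proof.
move=> hf hg; apply: (is_diff_eq (is_diffD hf hg)); apply/funext => h /=.
by rewrite dotpDl.
Qed.

Lemma hasgrad_sum (I : Type) (s : seq I) (f : I -> 'rV[R]_n -> R) x F :
  (forall i, hasgrad n (f i) x (F i)) ->
  hasgrad n (fun y => \sum_(i <- s) f i y) x (\sum_(i <- s) F i).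
Proof.
move=> hf; elim: s => [|i s IH].
  rewrite big_nil (_ : (fun y => _) = (fun=> 0)); first exact: hasgrad_cst.
  by apply/funext => y; rewrite big_nil.
rewrite big_cons (_ : (fun y => _) = (fun y => f i y + \sum_(i <- s) f i y)).
  exact: hasgradD.
by apply/funext => y; rewrite big_cons.
Qed.

Lemma hasgradM f g x F G :
  hasgrad n f x F -> hasgrad n g x G ->
  hasgrad n (fun y => f y * g y) x (f x *: G + g x *: F).
Proof.
move=> hf hg; apply: (is_diff_eq (is_diffM hf hg)); apply/funext => h /=.
by rewrite dotpDl !dotpZl.
Qed.

Lemma hasgradZ c f x F :
  hasgrad n f x F -> hasgrad n (fun y => c * f y) x (c *: F).
Proof.
move=> hf; apply: (is_diff_eq (is_diffZ c hf)); apply/funext => h /=.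
by rewrite dotpZl.
Qed.

Lemma hasgrad_coord i x : hasgrad n (fun y => y 0 i) x (delta_mx 0 i).
Proof.
pose c (y : 'rV[R]_n) : R := y 0 i.
have lc : linear c by move=> a u v; rewrite /c !mxE.
pose cl := GRing.isLinear.Build _ _ _ _ _ lc.
pose C : {linear 'rV[R]_n -> R} := HB.pack c cl.
apply: (is_diff_eq (is_diff_linear n R C x)); apply/funext => h /=.
by rewrite dotpC dotp_delta.
Qed.

Lemma hasgrad_enorm_sq x : hasgrad n (fun y => enorm y ^+ 2) x (2 *: x).
Proof.
rewrite (_ : (fun y => _) = (fun y : 'rV[R]_n => \sum_i y 0 i * y 0 i)); last first.
  by apply/funext => y; rewrite enorm_sq.
apply: hasgrad_eq.
  by apply: hasgrad_sum => i; apply: hasgradM; exact: hasgrad_coord.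
rewrite [in RHS](row_sum_delta x) scaler_sumr; apply: eq_bigr => i _.
by rewrite scaler_nat mulr2n.
Qed.

Lemma hasgrad_comp (h : R -> R) f x F (d : R) :
  is_derive (f x) 1 h d -> hasgrad n f x F -> hasgrad n (h \o f) x (d *: F).
Proof.
move=> hd hf.
have hh : is_diff (f x) h ( *:%R^~ d).
  by apply: DiffDef; [exact/derivable1_diffP|rewrite deriv1E // derive1E derive_val].
apply: (is_diff_eq (is_diff_comp hf hh)).
by apply/funext => v /=; rewrite dotpZl mulrC.
Qed.

(** The condition on [G'] says that it is the adjoint of [phi] applied to [G]. *)
Lemma hasgrad_affine m (phi : {linear 'rV[R]_n -> 'rV[R]_m}) c (F : 'rV[R]_m -> R) x
    (G : 'rV[R]_m) G' :
  hasgrad m F (phi x + c) G -> (forall h, dotp G (phi h) = dotp G' h) ->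
  hasgrad n (fun y => F (phi y + c)) x G'.
Proof.
move=> hF GG'.
have h1 : is_diff x (fun y => phi y + c) phi.
  apply: (is_diff_eq (is_diffD (is_diff_linear n _ phi x) (is_diff_cst c x))).
  by apply/funext => h; rewrite addrfctE /= addr0.
apply: (is_diff_eq (is_diff_comp h1 hF)).
by apply/funext => v /=.
Qed.

End Closure.

(** The error of the first-order expansion is at most h^2, even across the kink at 0. *)
Lemma is_derive_posq (s : R) :
  is_derive s 1 (fun t => Num.max 0 t ^+ 2) (2 * Num.max 0 s).
Proof.
set F := fun t => _; set D := 2 * _.
have bnd h : `|F (s + h) - F s - D * h| <= h ^+ 2.
  rewrite /F /D ler_norml.
  have [h1|h1] := leP 0 (s + h); have [h2|h2] := leP 0 s; apply/andP; split; nra.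
have lm : h^-1 *: ((F \o shift s) (h *: 1) - F s) @[h --> 0^'] --> D.
  apply/cvgrPdist_le => e e0; near=> h.
  have hn : h != 0 by near: h; exact: nbhs_dnbhs_neq.
  have he : `|h| <= e.
    near: h; apply: dnbhs0_le => //.
  rewrite /= [h%:A]mulr1 [h + s]addrC distrC.
  have -> : h^-1 *: (F (s + h) - F s) - D = h^-1 * (F (s + h) - F s - D * h).
    by rewrite /GRing.scale /=; field.
  rewrite normrM normfV ler_pdivrMl ?normr_gt0 //.
  apply: le_trans (bnd h) _; rewrite -real_normK ?num_real // expr2.
  by rewrite ler_wpM2l.
by split; [apply/cvg_ex; exists D|exact: cvg_lim].
Unshelve. all: by end_near. Qed.

Lemma hasgrad_bump n (rho : R) (z : 'rV[R]_n) : hasgrad n (bump n rho) z (dbump n rho z).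
Proof.
pose u (y : 'rV[R]_n) : R := rho ^+ 2 + (-1) * enorm y ^+ 2.
have hu : hasgrad n u z (0 + (-1) *: (2 *: z)).
  by apply: hasgradD; [exact: hasgrad_cst|apply: hasgradZ; exact: hasgrad_enorm_sq].
have := hasgrad_comp n _ u z _ _ (is_derive_posq (u z)) hu.
rewrite (_ : _ \o u = bump n rho); last first.
  by apply/funext => y; rewrite /bump /dip /u /= mulN1r.
move/hasgrad_eq; apply; apply/rowP => i; rewrite /dbump /dip !mxE /u mulN1r; ring.
Qed.

End Gradient.

(** * The hidden chain *)

Section Blocks.
Context {R : realType} (n M : nat).
Local Notation d := (n.+1 * M)%N.

(** A vector is read as a matrix whose n + 1 rows are the blocks; M is both the dimension of a block
    and the number of its candidate targets. *)
Definition blk (a : 'I_n.+1) : 'rV[R]_d -> 'rV[R]_M := row a \o vec_mx.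
HB.instance Definition _ a := GRing.Linear.copy (blk a) (row a \o vec_mx).

Definition emb (A : 'I_n.+1 -> 'rV[R]_M) : 'rV[R]_d := mxvec (\matrix_a A a).

Lemma blk_emb A a : blk a (emb A) = A a.
Proof. by rewrite /blk /emb /= mxvecK rowK. Qed.

Lemma blkB a (x y : 'rV[R]_d) : blk a (x - y) = blk a x - blk a y.
Proof. exact: linearB. Qed.

Lemma blkD a (x y : 'rV[R]_d) : blk a (x + y) = blk a x + blk a y.
Proof. exact: linearD. Qed.

Lemma blkZ a c (x : 'rV[R]_d) : blk a (c *: x) = c *: blk a x.
Proof. exact: linearZ_LR. Qed.

Lemma blkE a (x : 'rV[R]_d) i : blk a x 0 i = x 0 (mxvec_index a i).
Proof. by rewrite /blk /= !mxE. Qed.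

Lemma blk_inj (x y : 'rV[R]_d) : (forall a, blk a x = blk a y) -> x = y.
Proof.
move=> xy; apply: (can_inj vec_mxK); apply/row_matrixP => a; exact: xy.
Qed.

Lemma dotp_blk (x y : 'rV[R]_d) : dotp x y = \sum_a dotp (blk a x) (blk a y).
Proof.
rewrite /dotp (reindex _ (curry_mxvec_bij n.+1 M)) pair_bigA /=.
by apply: eq_bigr => -[a i] _ /=; rewrite !blkE.
Qed.

Lemma enorm_sq_blk (x : 'rV[R]_d) : enorm x ^+ 2 = \sum_a enorm (blk a x) ^+ 2.
Proof. by rewrite enorm_sq dotp_blk; apply: eq_bigr => a _; rewrite enorm_sq. Qed.

Lemma enorm_blk (x : 'rV[R]_d) a : enorm (blk a x) <= enorm x.
Proof.
apply: enorm_le; first exact: enorm_ge0.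
rewrite (enorm_sq_blk x) (bigD1 a) //= lerDl sumr_ge0 // => b _; exact: sqr_ge0.
Qed.

End Blocks.
Arguments blk {R n M}.
Arguments emb {R n M}.

Lemma sum_unique_le {R : realType} (I : finType) (F : I -> R) (C : R) :
  0 <= C -> (forall i, F i <= C) -> (forall i j, F i != 0 -> F j != 0 -> i = j) ->
  \sum_i F i <= C.
Proof.
move=> C0 FC Fu; have [[i Fi]|h] := pselect (exists i, F i != 0).
  rewrite (bigD1 i) //= big1 ?addr0 // => j ji; apply/eqP/negPn/negP => Fj.
  by move: ji; rewrite (Fu _ _ Fj Fi) eqxx.
by rewrite big1 // => i _; apply/eqP/negPn/negP => Fi; apply: h; exists i.
Qed.

(** Among the indices outside [r], only the smallest one can carry a nonzero term. *)
Lemma sum_before_le {R : realType} n (r : pred 'I_n) (F : 'I_n -> R) (C : R) :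
  0 <= C -> (forall a, F a <= C) -> (forall a b : 'I_n, (a < b)%N -> ~~ r a -> F b = 0) ->
  \sum_a (if r a then 0 else F a) <= C.
Proof.
move=> C0 FC F0; apply: sum_unique_le => // [a|a b]; first by case: ifP.
case: (boolP (r a)) => [_|ra]; first by rewrite eqxx.
case: (boolP (r b)) => [_ _|rb]; first by rewrite eqxx.
move=> ha hb; apply/val_inj/eqP; case: ltngtP => // ab.
  by move: hb; rewrite (F0 _ _ ab ra) eqxx.
by move: ha; rewrite (F0 _ _ ab rb) eqxx.
Qed.

Lemma sum_prev_le {R : realType} n (F : 'I_n.+1 -> R) : (forall i, 0 <= F i) ->
  \sum_(a : 'I_n.+1) (if a == 0 :> nat then 0 else F (inord a.-1)) <= \sum_a F a.
Proof.
move=> F0; rewrite big_ord_recl /= add0r [leRHS]big_ord_recr /=.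
rewrite -[leLHS]addr0 lerD // ler_sum // => i _; rewrite (_ : inord _ = widen_ord (leqnSn n) i) //.
by apply/val_inj; rewrite /= add0n inordK // ltnW // ltnS.
Qed.

Lemma sum_next_le {R : realType} n (F : 'I_n.+1 -> R) : (forall i, 0 <= F i) ->
  \sum_(a : 'I_n.+1) (if a == n :> nat then 0 else F (inord a.+1)) <= \sum_a F a.
Proof.
move=> F0; rewrite big_ord_recr /= eqxx addr0 [leRHS]big_ord_recl /=.
rewrite -[leLHS]add0r lerD // ler_sum // => i _.
rewrite ltn_eqF // (_ : inord _ = lift ord0 i) //.
by apply/val_inj; rewrite /= inordK ?ltnS.
Qed.

(** * The hard function and its gradient *)

Section HardInstance.
Context {R : realType} (n M : nat).
Local Notation d := (n.+1 * M)%N.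
Local Notation hidden := {ffun 'I_n.+1 -> 'I_M}.
Implicit Types (th : hidden) (a : 'I_n.+1) (x y : 'rV[R]_d).

Definition offset th a x : 'rV[R]_M := blk a x + - (2 *: delta_mx 0 (th a)).
(** Block a enters two links only: link a through the factor Phi, multiplied by [gate], and link a +
    1 through the factor Psi, multiplied by [reward]. [dlink_in] and [dlink_out] are the gradients
    of these two links in block a. *)
Definition gate th a x : R := if a == 0 :> nat then 1 else bump M 1 (offset th (inord a.-1) x).
Definition reward th a x : R := if a == n :> nat then 0 else bump M 4 (offset th (inord a.+1) x).
Definition dlink_in th a x : 'rV[R]_M := gate th a x *: dbump M 4 (offset th a x).
Definition dlink_out th a x : 'rV[R]_M := reward th a x *: dbump M 1 (offset th a x).

Definition chain th x : R :=
  2^-1 * enorm x ^+ 2 + (-1) * \sum_a gate th a x * bump M 4 (offset th a x).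
Definition dchain th x : 'rV[R]_d := emb (fun a => blk a x - dlink_in th a x - dlink_out th a x).

Lemma gate_ge0 th a x : 0 <= gate th a x.
Proof. by rewrite /gate; case: ifP => // _; exact: bump_ge0. Qed.
Lemma gate_le1 th a x : gate th a x <= 1.
Proof. by rewrite /gate; case: ifP => // _; rewrite -[leRHS](expr1n _ 4) bump_le. Qed.
Lemma reward_ge0 th a x : 0 <= reward th a x.
Proof. by rewrite /reward; case: ifP => // _; exact: bump_ge0. Qed.
Lemma reward_le th a x : reward th a x <= 4 ^+ 4.
Proof.
rewrite /reward; case: ifP => _; first exact: exprn_ge0.
exact: bump_le.
Qed.

Let emb1 a (v : 'rV[R]_M) : 'rV[R]_d := emb (fun b => if b == a then v else 0).

Let dotp_emb1 a v h : dotp (emb1 a v) h = dotp v (blk a h).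
Proof.
rewrite dotp_blk (bigD1 a) //= blk_emb eqxx big1 ?addr0 // => b ba.
by rewrite blk_emb (negbTE ba) /dotp big1 // => i _; rewrite mxE mul0r.
Qed.

Let hasgrad_bump_offset th a rho x :
  hasgrad d (fun y => bump M rho (offset th a y)) x (emb1 a (dbump M rho (offset th a x))).
Proof.
apply: (hasgrad_affine _ _ (blk a) _ (bump M rho) _ (dbump M rho (offset th a x))).
  exact: hasgrad_bump.
by move=> h; rewrite dotp_emb1.
Qed.

Lemma hasgrad_chain th x : hasgrad d (chain th) x (dchain th x).
Proof.
have hPsi a : hasgrad d (gate th a) x
    (if a == 0 :> nat then 0 else emb1 (inord a.-1) (dbump M 1 (offset th (inord a.-1) x))).
  rewrite /gate; case: ifP => _; [exact: hasgrad_cst|exact: hasgrad_bump_offset].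
apply: hasgrad_eq.
  apply: hasgradD; first by apply: hasgradZ; exact: hasgrad_enorm_sq.
  apply: hasgradZ; apply: hasgrad_sum => a.
  by apply: hasgradM; [exact: hPsi|exact: hasgrad_bump_offset].
apply: blk_inj => b; rewrite blk_emb linearD scalerA mulVf // scale1r -addrA.
congr (_ + _); rewrite scaleN1r linearN linear_sum -opprD; congr (- _).
under eq_bigr do rewrite linearD !linearZ_LR.
rewrite big_split /=; congr (_ + _).
  rewrite (bigD1 b) //= blk_emb eqxx big1 ?addr0 // => a ab.
  by rewrite blk_emb eq_sym (negbTE ab) scaler0.
(* Block b supplies the first factor of link b + 1 alone, and of no link when it is the last
   block. *)
rewrite /dlink_out /reward.
have [bn|bn] := eqVneq (b : nat) n.
  rewrite scale0r big1 // => a _; case: ifP => [_|a0]; first by rewrite linear0 scaler0.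
  rewrite blk_emb ifN ?scaler0 //; apply/eqP => /(congr1 val) /=.
  rewrite inordK; last by rewrite (leq_ltn_trans (leq_pred _)).
  by have := ltn_ord a; case: (a : nat) a0 => //= k _; rewrite ltnS bn => ? ?; lia.
have b1 : (b.+1 < n.+1)%N by rewrite ltnS ltn_neqAle bn -ltnS ltn_ord.
rewrite (bigD1 (inord b.+1)) //= big1 ?addr0 => [|a ab].
  by rewrite inordK //= inord_val blk_emb eqxx.
case: ifP => [_|a0]; first by rewrite linear0 scaler0.
rewrite blk_emb ifN ?scaler0 //; apply: contra ab => /eqP ->; apply/eqP/val_inj => /=.
rewrite !inordK //=; have := ltn_ord a; move: a0; case: (a : nat) => //= k _ ?; lia.
Qed.

(** The quadratic term is nonnegative and each of the n + 1 links is worth at most 4^4. *)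
Lemma chain_gap th x : chain th 0 - chain th x <= 4 ^+ 4 * n.+1%:R.
Proof.
have h1 : chain th 0 <= 0.
  rewrite /chain enorm0 expr0n mulr0 add0r mulN1r oppr_le0 sumr_ge0 // => a _.
  by rewrite mulr_ge0 ?gate_ge0 ?bump_ge0.
have h2 : \sum_a gate th a x * bump M 4 (offset th a x) <= 4 ^+ 4 * n.+1%:R.
  rewrite mulr_natr -[n.+1 in leRHS]card_ord -sumr_const ler_sum // => a _.
  rewrite -[leRHS]mul1r ler_pM ?gate_ge0 ?bump_ge0 ?gate_le1 //.
  exact: bump_le.
have h3 := sqr_ge0 (enorm x).
rewrite /chain in h1 *; lra.
Qed.

(** The threshold 1/2 is below the radius 1 of Psi: a captured block is within reach of its target
    and keeps the gate of the next link away from 0. *)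
Definition captured th x := [forall a, enorm (offset th a x) ^+ 2 <= 2^-1].

(** At the first uncaptured block the gradient has the form c z + 2 e_i, of norm at least c |z| - 2.
    For |z| >= 3 it is enough that c >= 1. For |z| < 3 the attraction of Phi gives c >= 8, while |z|
    >= 1/2. *)
Lemma dchain_ge1 th x : ~~ captured th x -> 1 <= enorm (dchain th x).
Proof.
rewrite negb_forall => /existsP[a0 ha0].
case: (@arg_minnP _ a0 (fun a => ~~ (enorm (offset th a x) ^+ 2 <= 2^-1)) val ha0).
move=> a ha amin.
(* By minimality of a the preceding block is captured, so its dip is at least 1/2 and its bump at
   least 1/4. *)
have Psia : 4^-1 <= gate th a x.
  rewrite /gate; case: ifP => [_|an0]; first lra.
  have : enorm (offset th (inord a.-1) x) ^+ 2 <= 2^-1.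
    apply/negPn/negP => h; have := amin _ h; rewrite /= inordK.
      by move: an0; case: (a : nat) => //= k _; rewrite ltnn.
    by rewrite (leq_ltn_trans (leq_pred _)).
  set r := enorm _; rewrite /bump -/r => hr.
  have : 2^-1 <= dip 1 r by rewrite /dip le_max; apply/orP; right; lra.
  nra.
apply: le_trans (enorm_blk _ _ _ a); rewrite blk_emb.
set z := offset th a x; set c := 1 + gate th a x * (4 * dip 4 (enorm z))
  + reward th a x * (4 * dip 1 (enorm z)).
(* Both bumps pull towards the target, which only increases c; the quadratic is centred at 0 rather
   than at the target, whence the remaining term 2 e_i. *)
have -> : blk a x - dlink_in th a x - dlink_out th a x = c *: z + 2 *: delta_mx 0 (th a).
  have -> : blk a x = z + 2 *: delta_mx 0 (th a) by rewrite /z /offset subrK.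
  rewrite /dlink_in /dlink_out /dbump -/z !scalerN !opprK !scalerA.
  by apply/rowP => i; rewrite /c !mxE; ring.
have := enormB _ (c *: z + 2 *: delta_mx 0 (th a)) (2 *: delta_mx 0 (th a)).
rewrite addrK !enormZ enorm_delta mulr1 (ger0_norm (_ : 0 <= 2)) // => hn.
move: ha; rewrite -/z -ltNge => hz.
have z0 := enorm_ge0 _ z.
have hQ : 0 <= reward th a x * (4 * dip 1 (enorm z)).
  by rewrite mulr_ge0 ?reward_ge0 // mulr_ge0 ?dip_ge0.
have hP : 0 <= gate th a x * (4 * dip 4 (enorm z)).
  by rewrite mulr_ge0 ?gate_ge0 // mulr_ge0 ?dip_ge0.
have c1 : 1 <= c by rewrite /c; lra.
rewrite ger0_norm in hn; last by lra.
have [h3|h3] := leP 3 (enorm z); first by nra.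
have hd : 7 <= dip 4 (enorm z) by rewrite /dip le_max; apply/orP; right; nra.
have hp7 : 7 <= gate th a x * (4 * dip 4 (enorm z)) by nra.
have c8 : 8 <= c by rewrite /c; lra.
have : 2^-1 <= enorm z by nra.
nra.
Qed.

End HardInstance.

(** * Smoothness with a constant independent of the number of blocks *)

Section Smoothness.
Context {R : realType} (n M : nat).
Local Notation d := (n.+1 * M)%N.
Local Notation hidden := {ffun 'I_n.+1 -> 'I_M}.
Implicit Types (th : hidden) (a : 'I_n.+1) (x y : 'rV[R]_d).

Lemma enorm_dlink_in th a x : enorm (dlink_in n M th a x) <= 4 ^+ 4.
Proof.
rewrite enormZ ger0_norm ?gate_ge0 // -[leRHS]mul1r ler_pM ?gate_ge0 ?enorm_ge0 ?gate_le1 //.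
by apply: le_trans (dbump_le _ _ _ _) _ => //; rewrite -exprS.
Qed.

Lemma enorm_dlink_out th a x : enorm (dlink_out n M th a x) <= 4 ^+ 5.
Proof.
rewrite enormZ ger0_norm ?reward_ge0 // exprSr.
rewrite ler_pM ?reward_ge0 ?enorm_ge0 ?reward_le //.
by apply: le_trans (dbump_le _ _ _ _) _ => //; rewrite expr1n mulr1.
Qed.

Lemma offsetB th a x y : offset n M th a x - offset n M th a y = blk a (x - y).
Proof. by rewrite /offset opprD addrACA subrr addr0 blkB. Qed.

Lemma gate_lip th a x y : `|gate n M th a x - gate n M th a y| <=
  4 * (if a == 0 :> nat then 0 else enorm (blk (inord a.-1) (x - y))).
Proof.
rewrite /gate; case: ifP => _; first by rewrite subrr normr0 mulr0.
apply: le_trans (bump_lip _ _ _ _ _) _ => //.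
by rewrite offsetB expr1n mulr1.
Qed.

Lemma reward_lip th a x y : `|reward n M th a x - reward n M th a y| <=
  4 ^+ 4 * (if a == n :> nat then 0 else enorm (blk (inord a.+1) (x - y))).
Proof.
rewrite /reward; case: ifP => _; first by rewrite subrr normr0 mulr0.
apply: le_trans (bump_lip _ _ _ _ _) _ => //.
by rewrite offsetB -exprS.
Qed.

Lemma scale_lip m (s t S T : R) (u v : 'rV[R]_m) :
  `|s| <= S -> enorm v <= T ->
  enorm (s *: u - t *: v) <= S * enorm (u - v) + `|s - t| * T.
Proof.
move=> hs hv; have -> : s *: u - t *: v = s *: (u - v) + (s - t) *: v.
  by apply/rowP => i; rewrite !mxE; ring.
apply: le_trans (enormD _ _ _) _; rewrite !enormZ.
by rewrite lerD // ?ler_wpM2r ?ler_wpM2l ?enorm_ge0.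
Qed.

Lemma dlink_in_lip th a x y : enorm (dlink_in n M th a x - dlink_in n M th a y) <=
  3 * 4 ^+ 3 * enorm (blk a (x - y)) +
  4 ^+ 5 * (if a == 0 :> nat then 0 else enorm (blk (inord a.-1) (x - y))).
Proof.
apply: le_trans (scale_lip _ _ _ 1 (4 ^+ 4) _ _ _ _) _.
- by rewrite ger0_norm ?gate_ge0 ?gate_le1.
- by apply: le_trans (dbump_le _ _ _ _) _ => //; rewrite -exprS.
have := gate_lip th a x y.
have : enorm (dbump M 4 (offset n M th a x) - dbump M 4 (offset n M th a y))
    <= 12 * 4 ^+ 2 * enorm (offset n M th a x - offset n M th a y) by exact: dbump_lip.
rewrite offsetB; lra.
Qed.

Lemma dlink_out_lip th a x y : enorm (dlink_out n M th a x - dlink_out n M th a y) <=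
  3 * 4 ^+ 5 * enorm (blk a (x - y)) +
  4 ^+ 5 * (if a == n :> nat then 0 else enorm (blk (inord a.+1) (x - y))).
Proof.
apply: le_trans (scale_lip _ _ _ (4 ^+ 4) 4 _ _ _ _) _.
- by rewrite ger0_norm ?reward_ge0 ?reward_le.
- by apply: le_trans (dbump_le _ _ _ _) _ => //; rewrite expr1n mulr1.
have := reward_lip th a x y.
have : enorm (dbump M 1 (offset n M th a x) - dbump M 1 (offset n M th a y))
    <= 12 * 1 ^+ 2 * enorm (offset n M th a x - offset n M th a y) by exact: dbump_lip.
rewrite offsetB; lra.
Qed.

(** A block of the gradient depends only on the same block of the point and its two neighbours.
    Squaring the sum of three terms costs a factor 3, and summing over blocks counts each block at
    most three times, so the constant 4^6 of a single block becomes 3 * 4^6. *)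
Lemma dchain_lip th x y : enorm (dchain n M th x - dchain n M th y) <= 3 * 4 ^+ 6 * enorm (x - y).
Proof.
apply: enorm_le; first by rewrite mulr_ge0 ?enorm_ge0.
rewrite enorm_sq_blk exprMn (enorm_sq_blk _ _ (x - y)).
set F := fun a => enorm (blk a (x - y)).
pose Fp a := if a == 0 :> nat then 0 else F (inord a.-1) ^+ 2.
pose Fn a := if a == n :> nat then 0 else F (inord a.+1) ^+ 2.
have step a : enorm (blk a (dchain n M th x - dchain n M th y)) ^+ 2 <=
    3 * (4 ^+ 6) ^+ 2 * (F a ^+ 2 + Fp a + Fn a).
  rewrite blkB !blk_emb.
  have -> : blk a x - dlink_in n M th a x - dlink_out n M th a x -
      (blk a y - dlink_in n M th a y - dlink_out n M th a y) =
      blk a (x - y) - (dlink_in n M th a x - dlink_in n M th a y)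
      - (dlink_out n M th a x - dlink_out n M th a y).
    by rewrite blkB; apply/rowP => i; rewrite !mxE; ring.
  set u := blk a (x - y).
  have h1 := enormB _ (u - (dlink_in n M th a x - dlink_in n M th a y))
    (dlink_out n M th a x - dlink_out n M th a y).
  have h2 := enormB _ u (dlink_in n M th a x - dlink_in n M th a y).
  have h3 := dlink_in_lip th a x y; have h4 := dlink_out_lip th a x y.
  rewrite -/u in h3 h4.
  have e0 := enorm_ge0 _ (u - (dlink_in n M th a x - dlink_in n M th a y) -
    (dlink_out n M th a x - dlink_out n M th a y)).
  have u0 := enorm_ge0 _ u.
  have p2 : (if a == 0 :> nat then 0 else F (inord a.-1)) ^+ 2 = Fp a.
    by rewrite /Fp; case: ifP => // _; rewrite expr0n.
  have n2 : (if a == n :> nat then 0 else F (inord a.+1)) ^+ 2 = Fn a.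
    by rewrite /Fn; case: ifP => // _; rewrite expr0n.
  have p0 : 0 <= (if a == 0 :> nat then 0 else F (inord a.-1)).
    by case: ifP => // _; exact: enorm_ge0.
  have n0 : 0 <= (if a == n :> nat then 0 else F (inord a.+1)).
    by case: ifP => // _; exact: enorm_ge0.
  rewrite -p2 -n2 -[F a]/(enorm u).
  move: e0 h1 h2 h3 h4 u0 p0 n0; rewrite /F.
  set E := enorm _; set A := enorm u; set B := if _ then _ else _; set C := if _ then _ else _.
  move=> E0 h1 h2 h3 h4 A0 B0 C0.
  have hE : E <= 4 ^+ 6 * (A + B + C) by lra.
  apply: (@le_trans _ _ ((4 ^+ 6 * (A + B + C)) ^+ 2)).
    by rewrite lerXn2r ?nnegrE //; lra.
  have := sqr_ge0 (A - B); have := sqr_ge0 (B - C); have := sqr_ge0 (A - C); nra.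
apply: le_trans (ler_sum _ (fun a _ => step a)) _.
rewrite -mulr_sumr 2!big_split /=.
have F2 a : 0 <= F a ^+ 2 by exact: sqr_ge0.
have := sum_prev_le n _ F2; have := sum_next_le n _ F2.
rewrite -/F.
rewrite -[X in X <= _ -> _]/(\sum_a Fn a) => h1.
rewrite -[X in X <= _ -> _]/(\sum_a Fp a) => h2.
move: h1 h2; lra.
Qed.

End Smoothness.

(** * The Bernoulli oracle *)

Section Oracle.
Context {R : realType} (n M : nat) (p : R).
Local Notation d := (n.+1 * M)%N.
Local Notation hidden := {ffun 'I_n.+1 -> 'I_M}.
Implicit Types (th : hidden) (a : 'I_n.+1) (x y : 'rV[R]_d) (k : nat) (xi : bool).

Definition active th a x : bool := enorm (offset n M th a x) < 1.
Definition reached th k x : bool := [exists a : 'I_n.+1, (k <= a)%N && active th a x].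
(** The factor of link k, used for both of its gradients, in block k and in block k - 1, so that a
    link is shown or hidden as a whole. It is exact when the query is close to the target of block k
    or of a later one. *)
Definition weight th k xi x : R := if reached th k x then 1 else xi%:R / p.

(* At most one unreached link has a nonzero gradient, so that the variance of this
   unbiased estimator is of order 1 / p. *)
Definition ochain th xi x : 'rV[R]_d := emb (fun a =>
  blk a x - weight th a xi x *: dlink_in n M th a x - weight th a.+1 xi x *: dlink_out n M th a x).

(** The unit balls around 2 e_i and 2 e_j are disjoint: coordinate i of a common point would be both
    above and below 1. *)
Lemma active_inj (th th' : hidden) a x : active th a x -> active th' a x -> th a = th' a.
Proof.
move=> h1 h2; apply/eqP/negPn/negP => ne.
have := enorm_coord _ (offset n M th a x) (th a).
have := enorm_coord _ (offset n M th' a x) (th a).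
rewrite !mxE !eqxx (negbTE ne) /= mulr0 oppr0 addr0 mulr1 => c2 c1.
have {}h1 := le_lt_trans c1 h1; have {}h2 := le_lt_trans c2 h2.
by move: h1 h2; rewrite !ltr_norml; lra.
Qed.

Lemma inactive_bump th a x : ~~ active th a x -> bump M 1 (offset n M th a x) = 0.
Proof. by rewrite -leNgt => h; apply: bump_eq0. Qed.

Lemma inactive_dbump th a x : ~~ active th a x -> dbump M 1 (offset n M th a x) = 0.
Proof. by rewrite -leNgt => h; apply: dbump_eq0. Qed.

Lemma reachedP th k a x : (k <= a)%N -> active th a x -> reached th k x.
Proof. by move=> ka ha; apply/existsP; exists a; rewrite ka. Qed.

Lemma gate_neq0 th a x : gate n M th a x != 0 ->
  a = 0 :> nat \/ exists2 b : 'I_n.+1, b.+1 = a & active th b x.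
Proof.
rewrite /gate; case: (eqVneq (a : nat) 0%N) => [|a0] h; first by left.
right; exists (inord a.-1).
  by rewrite inordK; [rewrite prednK ?lt0n|rewrite (leq_ltn_trans (leq_pred _))].
by apply: contraNT h => /inactive_bump ->.
Qed.

Lemma gate_eq0 th x k (b : 'I_n.+1) : (k < b)%N -> ~~ reached th k x -> gate n M th b x = 0.
Proof.
move=> ab nr; apply/eqP/negPn/negP => /gate_neq0[b0|[c cb ac]].
  by rewrite b0 in ab.
by move/negP: nr; apply; apply: reachedP ac; rewrite -ltnS cb.
Qed.

Lemma ochain_var th xi x :
  enorm (ochain th xi x - dchain n M th x) ^+ 2 <= 4 ^+ 11 * (xi%:R / p - 1) ^+ 2.
Proof.
set s := xi%:R / p - 1.
pose A a := if reached th a x then 0 else enorm (dlink_in n M th a x) ^+ 2.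
pose B a := if reached th a.+1 x then 0 else enorm (dlink_out n M th a x) ^+ 2.
have step a : enorm (blk a (ochain th xi x - dchain n M th x)) ^+ 2 <=
    2 * s ^+ 2 * (A a + B a).
  rewrite blkB !blk_emb.
  set u := dlink_in n M th a x; set v := dlink_out n M th a x.
  have -> : blk a x - weight th a xi x *: u - weight th a.+1 xi x *: v - (blk a x - u - v)
     = - ((weight th a xi x - 1) *: u + (weight th a.+1 xi x - 1) *: v).
    by apply/rowP => i; rewrite !mxE; ring.
  rewrite enormN.
  have h : enorm ((weight th a xi x - 1) *: u + (weight th a.+1 xi x - 1) *: v) ^+ 2 <=
     2 * ((weight th a xi x - 1) ^+ 2 * enorm u ^+ 2 +
          (weight th a.+1 xi x - 1) ^+ 2 * enorm v ^+ 2).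
    set U := _ *: u; set V := _ *: v.
    have := enormD _ U V; have := enorm_ge0 _ (U + V).
    rewrite -(real_normK (num_real (weight th a xi x - 1))).
    rewrite -(real_normK (num_real (weight th a.+1 xi x - 1))) -!exprMn -!enormZ -/U -/V.
    move: (enorm (U + V)) (enorm U) (enorm V) => e f g e0 efg.
    have := sqr_ge0 (f - g); nra.
  apply: le_trans h _; rewrite -mulrA ler_wpM2l // mulrDr lerD //.
    by rewrite /A /weight; case: ifP => // _; rewrite subrr expr0n !mul0r mulr0.
  by rewrite /B /weight; case: ifP => // _; rewrite subrr expr0n !mul0r mulr0.
(* If link a is unreached, no block from a on is active, so all gates after a are closed and all
   later Psi-gradients vanish. Hence each of the two sums has at most one nonzero term. *)
have hA : \sum_a A a <= 4 ^+ 8.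
  apply: sum_before_le => [|a|a b ab ra]; first exact: exprn_ge0.
    by rewrite (exprM _ 4 2) lerXn2r ?nnegrE ?enorm_ge0 ?exprn_ge0 // enorm_dlink_in.
  by rewrite /dlink_in (gate_eq0 _ _ _ _ ab ra) scale0r enorm0 expr0n.
have hB : \sum_a B a <= 4 ^+ 10.
  apply: (sum_before_le n.+1 (fun a => reached th a.+1 x)) => [|a|a b ab ra].
  - exact: exprn_ge0.
  - by rewrite (exprM _ 5 2) lerXn2r ?nnegrE ?enorm_ge0 ?exprn_ge0 // enorm_dlink_out.
  - rewrite /dlink_out inactive_dbump ?scaler0 ?enorm0 ?expr0n //.
    by apply: contra ra => /(reachedP th a.+1 b x ab).
rewrite enorm_sq_blk; apply: le_trans (ler_sum _ (fun a _ => step a)) _.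
rewrite -mulr_sumr big_split /=.
have := sqr_ge0 s; nra.
Qed.

Lemma ochain_mean th x : p != 0 ->
  p *: ochain th true x + (1 - p) *: ochain th false x = dchain n M th x.
Proof.
move=> p0; apply: blk_inj => a; rewrite blkD !blkZ !blk_emb.
have hw k : p * weight th k true x + (1 - p) * weight th k false x = 1.
  rewrite /weight; case: ifP => _; first by ring.
  by rewrite mulr0n mulr1n mul0r mulr0 addr0 mulrC divfK.
move: (blk a x) (dlink_in n M th a x) (dlink_out n M th a x) => b P Q.
rewrite -[RHS](_ : b - (p * weight th a true x + (1 - p) * weight th a false x) *: P
    - (p * weight th a.+1 true x + (1 - p) * weight th a.+1 false x) *: Q = _).
  by apply/rowP => i; rewrite !mxE; ring.
by rewrite !hw !scale1r.
Qed.

Definition agree k th th' := forall a, (a < k)%N -> th a = th' a.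
Definition noleak k th x := forall a, (k <= a)%N -> ~~ active th a x.

Lemma offset_local th th' a x : th a = th' a -> offset n M th a x = offset n M th' a x.
Proof. by rewrite /offset => ->. Qed.

(* A query thus reveals at most one new index, and only when xi = 1. *)
Lemma ochain_local l th th' xi x : agree l th th' -> noleak l th x -> noleak l th' x ->
  (xi -> agree l.+1 th th') -> ochain th xi x = ochain th' xi x.
Proof.
move=> ag nl nl' agx.
have zE := offset_local th th' ^~ x.
have acE a : active th a x = active th' a x.
  have [al|la] := ltnP a l; first by rewrite /active zE // ag.
  by rewrite (negbTE (nl _ la)) (negbTE (nl' _ la)).
have wE k : weight th k xi x = weight th' k xi x.
  have rE : reached th k x = reached th' k x by apply: eq_existsb => a; rewrite acE.
  by rewrite /weight rE.
have wl k : (l <= k)%N -> weight th k xi x = xi%:R / p.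
  move=> lk; rewrite /weight ifN //; apply/existsPn => a; rewrite negb_and.
  by case: leqP => //= ka; apply: nl; exact: leq_trans ka.
(* Either the coin erases link k, or the two hidden vectors share its index as well. *)
have agl k : (k <= l)%N -> xi%:R / p = 0 \/ agree k.+1 th th'.
  move=> kl; case: xi agx {wE wl} => [agx|_]; last by left; rewrite mul0r.
  by right => a ak; apply: (agx isT); exact: leq_trans ak _.
have PE a : agree a.+1 th th' -> dlink_in n M th a x = dlink_in n M th' a x.
  move=> aga; have PsE : gate n M th a x = gate n M th' a x.
    rewrite /gate; have [//|a0] := eqVneq (a : nat) 0%N; congr bump; apply: zE; apply: aga.
    by rewrite inordK (leq_ltn_trans (leq_pred _)).
  by rewrite /dlink_in PsE zE //; exact: aga.
have QE a : agree a.+2 th th' -> dlink_out n M th a x = dlink_out n M th' a x.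
  move=> aga; have PhE : reward n M th a x = reward n M th' a x.
    rewrite /reward; have [//|an] := eqVneq (a : nat) n; congr bump; apply: zE; apply: aga.
    by rewrite inordK // ltnS ltn_neqAle an -ltnS ltn_ord.
  by rewrite /dlink_out PhE zE //; exact: aga.
have sub k : (k <= l)%N -> agree k th th' by move=> kl a ak; apply: ag; exact: leq_trans ak kl.
(* Links before l involve only shared indices, links after l have a closed gate, and link l is the
   one that the coin guards. For [dlink_out] the same split applies to link a + 1, with the gradient
   of Psi vanishing once a >= l. *)
have hP a : weight th a xi x *: dlink_in n M th a x = weight th' a xi x *: dlink_in n M th' a x.
  rewrite -wE; case: (ltngtP a l) => [al|la|al].
  - by rewrite PE //; exact: sub.
  - have PS0 t : noleak l t x -> gate n M t a x = 0.
      move=> nlt; apply/eqP/negPn/negP => /gate_neq0[a0|[b ba]]; first by rewrite a0 in la.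
      by apply/negP/nlt; rewrite -ltnS ba.
    by rewrite /dlink_in (PS0 _ nl) (PS0 _ nl') !scale0r.
  - have [w0|/PE -> //] := agl a (eq_leq al).
    rewrite (wl _ (eq_leq (esym al))) w0 !scale0r; reflexivity.
have hQ a : weight th a.+1 xi x *: dlink_out n M th a x =
    weight th' a.+1 xi x *: dlink_out n M th' a x.
  rewrite -wE; have [la|al] := leqP l a.
    rewrite /dlink_out (inactive_dbump _ _ _ (nl _ la)).
    by rewrite (inactive_dbump _ _ _ (nl' _ la)) !scaler0.
  case: (ltngtP a.+1 l) => [al'|la|al'].
  - by rewrite QE //; exact: sub.
  - by exfalso; move: la; rewrite ltnNge al.
  - have [w0|/QE -> //] := agl a.+1 (eq_leq al').
    rewrite (wl _ (eq_leq (esym al'))) w0 !scale0r; reflexivity.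
apply: (congr1 emb); apply/funext => a.
exact: (congr2 (fun u v => blk a x - u - v) (hP a) (hQ a)).
Qed.

End Oracle.

(** * Membership in the class *)

Section ClassMembership.
Context {R : realType} (dx dy : nat).
Local Notation N := (dx + dy)%N.

Lemma hasgrad_lsubmx (h : 'rV[R]_dx -> R) (G : 'rV[R]_dx) (z : 'rV[R]_N) :
  hasgrad dx h (lsubmx z) G -> hasgrad N (fun z => h (lsubmx z)) z (row_mx G 0).
Proof.
move=> hG; have -> : (fun z : 'rV[R]_N => h (lsubmx z)) = (fun z => h (lsubmx z + 0)).
  by apply/funext => y; rewrite addr0.
apply: (hasgrad_affine _ _ lsubmx 0 h _ G); first by rewrite addr0.
move=> v; rewrite -[v in RHS]hsubmxK dotp_row_mx
  [X in _ = _ + X]big1 ?addr0 // => i _.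
by rewrite mxE mul0r.
Qed.

Lemma hasgrad_rsubmx (h : 'rV[R]_dy -> R) (G : 'rV[R]_dy) (z : 'rV[R]_N) :
  hasgrad dy h (rsubmx z) G -> hasgrad N (fun z => h (rsubmx z)) z (row_mx 0 G).
Proof.
move=> hG; have -> : (fun z : 'rV[R]_N => h (rsubmx z)) = (fun z => h (rsubmx z + 0)).
  by apply/funext => y; rewrite addr0.
apply: (hasgrad_affine _ _ rsubmx 0 h _ G); first by rewrite addr0.
move=> v; rewrite -[v in RHS]hsubmxK dotp_row_mx
  [X in _ = X + _]big1 ?add0r // => i _.
by rewrite mxE mul0r.
Qed.

(** [Dy] applies the directions from the end of the list, so a map that is constant after [vs] is
    annihilated by [v] and stays 0 under the directions [w] in front of it. *)
Lemma Dy_const m (h : 'rV[R]_N -> 'rV[R]_m) x (c : 'rV[R]_m) (v : 'rV[R]_dy) vs :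
  (forall y, Dy h x vs y = c) -> forall w y, Dy h x (w ++ v :: vs) y = 0.
Proof.
move=> hc; elim=> [|u w IH] y /=.
  by rewrite (_ : Dy h x vs = fun=> c) ?derive_const //; exact/funext.
by rewrite (_ : Dy h x (w ++ v :: vs) = fun=> 0) ?derive_const //; exact/funext.
Qed.

Section IndependentOfY.
Variables (p : nat) (L : nat -> R) (mu Delta : R) (h : 'rV[R]_dx -> R).
Variable (dh : 'rV[R]_dx -> 'rV[R]_dx).
Hypothesis Lpos : forall i, (i <= p.+1)%N -> 0 < L i.
Hypotheses (p0 : (0 < p)%N) (mu0 : 0 < mu) (muL : mu <= L 1%N).
Hypothesis hdh : forall x, hasgrad dx h x (dh x).
Hypothesis dh_lip : forall x y, enorm (dh x - dh y) <= L 1%N * enorm (x - y).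
Hypothesis h_gap : forall x, h 0 - h x <= Delta.

Let f (z : 'rV[R]_N) : R := h (lsubmx z).
Let g (z : 'rV[R]_N) : R := mu / 2 * enorm (rsubmx z) ^+ 2.

Lemma phi_lsubmx : phi f g = h.
Proof. by apply/funext => x; rewrite /phi /f row_mxKl. Qed.

Lemma grad_lsubmx z : grad f z = row_mx (dh (lsubmx z)) 0.
Proof. exact/hasgrad_grad/hasgrad_lsubmx. Qed.

Lemma hasgrad_quad z : hasgrad N g z (row_mx 0 (mu *: rsubmx z)).
Proof.
apply: (hasgrad_rsubmx (fun y => mu / 2 * enorm y ^+ 2)).
apply: hasgrad_eq; first by apply: hasgradZ; exact: hasgrad_enorm_sq.
by rewrite scalerA divfK.
Qed.

Lemma grad_quad z : grad g z = row_mx 0 (mu *: rsubmx z).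
Proof. exact/hasgrad_grad/hasgrad_quad. Qed.

Let row0 (y : 'rV[R]_dy) : 'rV[R]_N := row_mx 0 (mu *: y).

Let row0_linear : linear row0.
Proof.
move=> a u v; rewrite /row0 scale_row_mx add_row_mx scaler0 addr0 scalerDr !scalerA.
by rewrite [a * _]mulrC.
Qed.

HB.instance Definition _ := GRing.isLinear.Build _ _ _ _ row0 row0_linear.

Let grad_g x : (fun y => grad g (row_mx x y)) = row0.
Proof. by apply/funext => y; rewrite grad_quad row_mxKr. Qed.

Lemma Dy_grad_lsubmx x vs y :
  Dy (grad f) x vs y = if vs is [::] then row_mx (dh x) 0 else 0.
Proof.
case/lastP: vs => [|vs v] /=; first by rewrite grad_lsubmx row_mxKl.
rewrite -cats1 (Dy_const _ _ _ (row_mx (dh x) 0)); first by case: vs.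
by move=> y' /=; rewrite grad_lsubmx row_mxKl.
Qed.

Lemma Dy_grad_quad x vs y :
  Dy (grad g) x vs y = match vs with [::] => row0 y | [:: v] => row0 v | _ => 0 end.
Proof.
case/lastP: vs => [|vs v] /=; first by rewrite grad_quad row_mxKr.
have h1 y' : Dy (grad g) x [:: v] y' = row0 v by rewrite /= grad_g derive_linear.
case/lastP: vs => [|vs w]; first exact: h1.
rewrite -!cats1 -catA (Dy_const _ _ _ (row0 v)) //.
by case: vs => // ? [].
Qed.

(** As f ignores y, [phi] is [h] whatever the argmin. The y-derivatives of [grad f] vanish and those
    of [grad g] are constant from the first order on, so the higher-order conditions hold with any
    positive constants; mu <= L 1 makes g smooth. *)
Lemma in_class_lsubmx : in_class p L mu Delta f g.
Proof.
have L1 : 0 <= L 1%N by exact/ltW/Lpos.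
have diffc (W : normedModType R) (c : W) (y : 'rV[R]_dy) : differentiable (fun=> c) y.
  exact: differentiable_cst.
split; first by move=> x; rewrite phi_lsubmx.
split.
  move=> x y y' t /andP[t0 t1]; rewrite /g !row_mxKr !enorm_sq.
  rewrite !(dotpDl, dotpDr, dotpNl, dotpNr, dotpZl, dotpZr) (dotpC _ y' y).
  rewrite le_eqVlt; apply/predU1P; left; ring.
split.
  move=> x y y'; rewrite /f !row_mxKl subrr normr0 mulr_ge0 ?enorm_ge0 //.
  exact/ltW/Lpos.
split; first by move=> z; apply: hasgrad_differentiable; exact: hasgrad_lsubmx.
split; first by move=> z; apply: hasgrad_differentiable; exact: hasgrad_quad.
split.
  move=> z z'; rewrite !grad_lsubmx opp_row_mx add_row_mx subr0 enorm_row_mx0.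
  apply: le_trans (dh_lip _ _) _; rewrite -linearB ler_wpM2l //.
  exact: enorm_lsubmx.
split.
  move=> z z'; rewrite !grad_quad opp_row_mx add_row_mx subr0 enorm_row_0mx.
  rewrite -scalerBr -linearB enormZ gtr0_norm //.
  by rewrite ler_pM ?enorm_ge0 ?enorm_rsubmx // ltW.
have ydiff_g m : ydiff (grad g) m.
  move=> x vs y _; case/lastP: vs => [|vs v].
    rewrite (_ : Dy _ x [::] = row0); last by apply/funext => y'; rewrite Dy_grad_quad.
    by case: (is_diff_linear _ _ row0 y).
  rewrite (_ : Dy _ x _ = fun=> Dy (grad g) x (rcons vs v) 0); first exact: diffc.
  by apply/funext => y'; rewrite !Dy_grad_quad; case: vs => [|? []].
have HD x y v : 'D_v (fun y' => grad g (row_mx x y')) y = row0 v.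
  by rewrite grad_g derive_linear.
split; first exact: ydiff_g.
split.
  move=> x y x' y' v; rewrite /Hxy !HD subrr enorm0.
  by rewrite !mulr_ge0 ?enorm_ge0 // ltW // Lpos // !ltnS.
split.
  move=> x y x' y' v; rewrite /Hyy !HD subrr enorm0.
  by rewrite !mulr_ge0 ?enorm_ge0 // ltW // Lpos // !ltnS.
split.
  move=> x vs y _; rewrite (_ : Dy _ x vs = fun=> Dy (grad f) x vs 0); first exact: diffc.
  by apply/funext => y'; rewrite !Dy_grad_lsubmx.
split; first exact: ydiff_g.
move=> q /andP[q1 qp].
split=> x vs y y' hq.
  rewrite !Dy_grad_lsubmx subrr enorm0 !mulr_ge0 ?enorm_ge0 ?prodr_ge0 //.
    by apply/ltW/Lpos; move: qp; lia.
  by move=> v _; exact: enorm_ge0.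
rewrite !Dy_grad_quad; case: vs hq => [|? [|? ?]] //= hq; first by move: hq q1 => [<-].
rewrite subrr enorm0 !mulr_ge0 ?enorm_ge0 ?prodr_ge0 //.
  by apply/ltW/Lpos; move: qp; lia.
by move=> v _; exact: enorm_ge0.
Qed.

End IndependentOfY.
End ClassMembership.

(** * Measurability and integration *)

Section UniformNat.
Context {R : realType} (k : nat).

Let inv_ge0 : 0 <= k.+1%:R^-1 :> R. Proof. by rewrite invr_ge0. Qed.

(** Serves to draw an instance by its position in an enumeration. There are k + 1 atoms, the
    positions 0 to k, so the normalisation never divides by 0. *)
Definition unif_nat : set nat -> \bar R :=
  mscale (NngNum inv_ge0) (msum (fun i : nat => @dirac _ nat i R) k.+1).

HB.instance Definition _ := Measure.on unif_nat.

Let unif_natT : unif_nat [set: nat] = 1%E.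
Proof.
rewrite /unif_nat /mscale /= /msum.
have -> : (\sum_(i < k.+1) @dirac _ nat i R [set: nat])%R = \sum_(i < k.+1) (1%:E : \bar R).
  by apply: eq_bigr => i _; exact: diracT.
by rewrite sumEFin sumr_const card_ord -EFinM mulVf.
Qed.

HB.instance Definition _ := Measure_isProbability.Build _ _ _ unif_nat unif_natT.

Lemma integral_unif_nat (f : nat -> \bar R) : (forall i, 0 <= f i)%E ->
  (\int[unif_nat]_i f i = (k.+1%:R^-1)%:E * \sum_(i < k.+1) f i)%E.
Proof.
move=> f0; rewrite ge0_integral_mscale //= ge0_integral_measure_sum //.
congr (_ * _)%E; apply: eq_bigr => i _.
by rewrite integral_dirac // diracT mul1e.
Qed.

End UniformNat.

Section Bernoulli.
Context {R : realType} (p : R).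
Hypothesis p01 : 0 <= p <= 1.

Lemma integral_bernoulli_EFin (f : bool -> R) :
  (\int[bernoulli_prob p]_b (f b)%:E = (p * f true + (1 - p) * f false)%:E)%E.
Proof.
(* The Bernoulli formula is for nonnegative functions, hence the split into positive and negative
   parts. *)
rewrite integralE !integral_bernoulli_prob //= !funeposE !funenegE.
have mE (x : R) : maxe x%:E 0%R = (Num.max x 0)%:E by exact/esym/EFin_max.
rewrite -!EFinN !mE -!EFinM -!EFinD; congr EFin; rewrite /unstable.onem.
have maxB (x : R) : x = Num.max x 0 - Num.max (- x) 0.
  by have [h|h] := leP x 0; have [h'|h'] := leP (- x) 0; lra.
by rewrite [in RHS](maxB (f true)) [in RHS](maxB (f false)); ring.
Qed.

Lemma bernoulli_integrable (f : bool -> R) :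
  (bernoulli_prob p).-integrable setT (fun b => (f b)%:E).
Proof.
apply/integrableP; split; first by [].
under eq_integral do rewrite abse_EFin.
by rewrite integral_bernoulli_EFin ltry.
Qed.

End Bernoulli.

Section RowMeasurability.
Context {R : realType} d (T : measurableType d).
Local Notation mf := (measurable_fun [set: T]).

Definition measurable_row n (f : T -> 'rV[R]_n) := forall i, mf (fun t => f t 0 i).

Lemma measurable_row_cst n (c : 'rV[R]_n) : measurable_row n (fun=> c).
Proof. by move=> i; exact: measurable_cst. Qed.

Lemma measurable_rowD n f g : measurable_row n f -> measurable_row n g ->
  measurable_row n (fun t => f t + g t).
Proof.
move=> hf hg i; under eq_fun do rewrite mxE.
exact: measurable_funD.
Qed.

Lemma measurable_rowN n f : measurable_row n f -> measurable_row n (fun t => - f t).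
Proof. by move=> hf i; under eq_fun do rewrite mxE; exact: measurable_funN. Qed.

Lemma measurable_rowB n f g : measurable_row n f -> measurable_row n g ->
  measurable_row n (fun t => f t - g t).
Proof. by move=> hf hg; apply: measurable_rowD => //; exact: measurable_rowN. Qed.

Lemma measurable_rowZ n (s : T -> R) f : mf s -> measurable_row n f ->
  measurable_row n (fun t => s t *: f t).
Proof. by move=> hs hf i; under eq_fun do rewrite mxE; exact: measurable_funM. Qed.

Lemma measurable_row_row_mx n m f g : measurable_row n f -> measurable_row m g ->
  measurable_row (n + m) (fun t => row_mx (f t) (g t)).
Proof.
move=> hf hg i; under eq_fun do rewrite mxE.
by case: (fintype.split i) => j; [exact: hf|exact: hg].
Qed.

Lemma measurable_row_r2t n f : measurable_row n f -> mf (fun t => r2t (f t)).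
Proof.
move=> hf; apply/measurable_fun_tnthP => i.
by rewrite (_ : _ \o _ = fun t => f t 0 i) //; apply/funext => t /=; rewrite tnth_mktuple.
Qed.

Lemma measurable_row_t2r n (f : T -> n.-tuple R) : mf f -> measurable_row n (fun t => t2r (f t)).
Proof.
move=> hf i; rewrite (_ : (fun t => _) = (fun v => tnth v i) \o f).
  by apply: measurableT_comp => //; exact: measurable_tnth.
by apply/funext => t /=; rewrite mxE.
Qed.

Lemma measurable_enorm n f : measurable_row n f -> mf (fun t => enorm (f t)).
Proof.
move=> hf; apply: (measurableT_comp (f := @Num.sqrt R)).
  by apply: continuous_measurable_fun; exact: sqrt_continuous.
by apply: measurable_sum => i; exact: measurable_funX.
Qed.

Lemma measurable_exists (I : finType) (P : I -> T -> bool) :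
  (forall i, mf (P i)) -> mf (fun t => [exists i, P i t]).
Proof.
move=> hP; rewrite (_ : (fun t => _) = fun t => \big[orb/false]_i P i t); last first.
  by apply/funext => t; rewrite big_orE.
elim: (index_enum I) => [|i s IH]; first by under eq_fun do rewrite big_nil; exact: measurable_cst.
by under eq_fun do rewrite big_cons; exact: measurable_or.
Qed.

Section HiddenChain.
Variables (n M : nat) (th : {ffun 'I_n.+1 -> 'I_M}) (p : R).
Variable x : T -> 'rV[R]_(n.+1 * M)%N.
Hypothesis mx : measurable_row _ x.

Lemma measurable_row_blk a : measurable_row M (fun t => blk a (x t)).
Proof. by move=> i; under eq_fun do rewrite blkE; exact: mx. Qed.

Lemma measurable_row_emb (A : 'I_n.+1 -> T -> 'rV[R]_M) :
  (forall a, measurable_row M (A a)) -> measurable_row _ (fun t => emb (fun a => A a t)).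
Proof.
move=> hA k; have [g _ gK] := curry_mxvec_bij n.+1 M.
rewrite -(gK k) //; case: (g k) => a i /=.
by under eq_fun do rewrite -blkE blk_emb; exact: hA.
Qed.

Lemma measurable_row_offset a : measurable_row M (fun t => offset n M th a (x t)).
Proof. by apply: measurable_rowD; [exact: measurable_row_blk|exact: measurable_row_cst]. Qed.

Lemma measurable_dip rho a : mf (fun t => dip rho (enorm (offset n M th a (x t)))).
Proof.
apply: (measurable_maxr (f := fun=> 0)); first exact: measurable_cst.
apply: measurable_funB; first exact: measurable_cst.
by apply: measurable_funX; apply: measurable_enorm; exact: measurable_row_offset.
Qed.

Lemma measurable_bump rho a : mf (fun t => bump M rho (offset n M th a (x t))).
Proof. by apply: measurable_funX; exact: measurable_dip. Qed.

Lemma measurable_row_dbump rho a : measurable_row M (fun t => dbump M rho (offset n M th a (x t))).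
Proof.
apply: measurable_rowN; apply: measurable_rowZ; last exact: measurable_row_offset.
by apply: measurable_funM; [exact: measurable_cst|exact: measurable_dip].
Qed.

Lemma measurable_row_dlink_in a : measurable_row M (fun t => dlink_in n M th a (x t)).
Proof.
apply: measurable_rowZ; last exact: measurable_row_dbump.
apply: measurable_fun_ifT; [exact: measurable_cst|exact: measurable_cst|].
exact: measurable_bump.
Qed.

Lemma measurable_row_dlink_out a : measurable_row M (fun t => dlink_out n M th a (x t)).
Proof.
apply: measurable_rowZ; last exact: measurable_row_dbump.
apply: measurable_fun_ifT; [exact: measurable_cst|exact: measurable_cst|].
exact: measurable_bump.
Qed.

Lemma measurable_weight k xi : mf (fun t => weight n M p th k xi (x t)).
Proof.
apply: measurable_fun_ifT; [|exact: measurable_cst|exact: measurable_cst].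
apply: measurable_exists => a; apply: measurable_and; first exact: measurable_cst.
apply: measurable_fun_ltr; last exact: measurable_cst.
by apply: measurable_enorm; exact: measurable_row_offset.
Qed.

Lemma measurable_row_dchain : measurable_row _ (fun t => dchain n M th (x t)).
Proof.
apply: measurable_row_emb => a; apply: measurable_rowB; last exact: measurable_row_dlink_out.
by apply: measurable_rowB; [exact: measurable_row_blk|exact: measurable_row_dlink_in].
Qed.

Lemma measurable_row_ochain xi : measurable_row _ (fun t => ochain n M p th xi (x t)).
Proof.
apply: measurable_row_emb => a; apply: measurable_rowB; last first.
  by apply: measurable_rowZ; [exact: measurable_weight|exact: measurable_row_dlink_out].
apply: measurable_rowB; first exact: measurable_row_blk.
by apply: measurable_rowZ; [exact: measurable_weight|exact: measurable_row_dlink_in].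
Qed.

End HiddenChain.
End RowMeasurability.

Lemma measurable_rcons d d' (T : measurableType d) (T' : measurableType d') k
    (f : T -> k.-tuple T') (g : T -> T') :
  measurable_fun setT f -> measurable_fun setT g ->
  measurable_fun setT (fun t => [tuple of rcons (f t) (g t)]).
Proof.
move=> mf mg; apply/measurable_fun_tnthP => i.
have [ik|ki] := ltnP i k.
  rewrite (_ : _ \o _ = (fun v => tnth v (Ordinal ik)) \o f).
    by apply: measurableT_comp => //; exact: measurable_tnth.
  apply/funext => t /=; rewrite (tnth_nth (g t)) [RHS](tnth_nth (g t)) /=.
  by rewrite nth_rcons size_tuple ik.
rewrite (_ : _ \o _ = g) //; apply/funext => t /=.
rewrite (tnth_nth (g t)) /= nth_rcons size_tuple ltnNge ki /=.
by rewrite (_ : i == k :> nat) // eqn_leq ki -ltnS ltn_ord.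
Qed.

(** * The guessing game *)

(** The value of F common to all of P can be frozen, after which the sum may be enlarged to Q. In
    the game, F is the answer to a query and P a set of hidden vectors that this answer does not
    separate. *)
Lemma sum_common_le {R : realType} (I : finType) (B : Type) (P Q : pred I) (F : I -> B)
    (W : I -> B -> R) (c : R) :
  (forall i, P i -> Q i) -> (forall i j, P i -> P j -> F i = F j) ->
  (forall i v, 0 <= W i v) -> 0 <= c -> (forall v, \sum_(i | Q i) W i v <= c) ->
  \sum_(i | P i) W i (F i) <= c.
Proof.
move=> PQ FF W0 c0 Wc; have [[i Pi]|h] := pselect (exists i, P i); last first.
  by rewrite big1 // => i Pi; case: h; exists i.
rewrite (eq_bigr (fun j => W j (F i))) => [|j Pj]; last by rewrite (FF _ _ Pj Pi).
apply: le_trans (Wc (F i)); rewrite big_mkcond [leRHS]big_mkcond /=.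
by apply: ler_sum => j _; case: ifP => [/PQ ->|_] //; case: ifP.
Qed.

Section Agreement.
Variables (n M : nat).
Local Notation hidden := {ffun 'I_n.+1 -> 'I_M}.
Implicit Types th : hidden.

Definition agreeb (l : nat) th th' : bool := [forall a : 'I_n.+1, (a < l)%N ==> (th a == th' a)].

Lemma agreebP l th th' :
  reflect (forall a : 'I_n.+1, (a < l)%N -> th a = th' a) (agreeb l th th').
Proof.
apply: (iffP forallP) => [h a al|h a]; first by apply/eqP; move/implyP: (h a); apply.
by apply/implyP => al; rewrite h.
Qed.

(** Index j is still free, hence equidistributed over M values: both sets are products that differ
    only in the factor j. *)
Lemma card_agree_slice l th0 (j : 'I_n.+1) i : (l <= j)%N ->
  (#|[pred th | agreeb l th0 th & th j == i]| * M = #|[pred th | agreeb l th0 th]|)%N.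
Proof.
move=> lj.
pose F (a : 'I_n.+1) : simpl_pred 'I_M := if (a < l)%N then pred1 (th0 a) else predT.
pose F' (a : 'I_n.+1) : simpl_pred 'I_M := if a == j then pred1 i else F a.
have e1 : [pred th | agreeb l th0 th] =i family F.
  move=> th; rewrite !inE; apply/agreebP/familyP => h a.
    rewrite /F; case: ifP => // al; rewrite inE eq_sym; exact/eqP/h.
  by move=> al; have := h a; rewrite /F al inE => /eqP.
have e2 : [pred th | agreeb l th0 th & th j == i] =i family F'.
  move=> th; rewrite !inE; apply/andP/familyP => [[/agreebP h /eqP hj] a|h].
    rewrite /F'; case: eqP => [->|_]; first by rewrite inE hj.
    rewrite /F; case: ifP => // al; rewrite inE eq_sym; exact/eqP/h.
  split; last by have := h j; rewrite /F' eqxx inE.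
  apply/agreebP => a al; have := h a; rewrite /F' /F al.
  by case: eqP => [aj|_]; [move: al; rewrite aj ltnNge lj|rewrite inE => /eqP].
rewrite (eq_card e1) (eq_card e2) !card_family !foldrE !big_image /=.
rewrite (bigD1 j) //= [RHS](bigD1 j) //= /F' eqxx card1 mul1n mulnC; congr (_ * _)%N.
  by rewrite /F ltnNge lj /= card_ord.
by apply: eq_bigr => a aj; rewrite (negbTE aj).
Qed.

(** Changing index l of the reference vector enumerates the classes of agreement up to l + 1 inside
    a class of agreement up to l. *)
Definition set_hidden th (j : 'I_n.+1) (i : 'I_M) : hidden :=
  [ffun a => if a == j then i else th a].

Lemma agreeb_succ l th0 th (j : 'I_n.+1) i : j = l :> nat ->
  agreeb l.+1 (set_hidden th0 j i) th = agreeb l th0 th && (th j == i).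
Proof.
move=> jl; apply/agreebP/andP => [h|[/agreebP h /eqP hj] a].
  split; last by have := h j; rewrite ffunE eqxx jl ltnSn => ->.
  apply/agreebP => a al; have := h a; rewrite ffunE ltnS ltnW //.
  by case: eqP => [aj|_ -> //]; move: al; rewrite aj jl ltnn.
rewrite ltnS leq_eqVlt ffunE; case: (a =P j) => [-> _|aj]; first by rewrite hj.
by case/orP => [/eqP al|/h //]; case: aj; apply/val_inj; rewrite /= jl.
Qed.

End Agreement.

Section Game.
Context {R : realType} (n M : nat) (Q Ob : Type) (p : R).
Local Notation hidden := {ffun 'I_n.+1 -> 'I_M}.
Variables (query : forall k, k.-tuple Ob -> Q) (ans : hidden -> bool -> Q -> Ob).
Variables (act : hidden -> 'I_n.+1 -> Q -> bool) (won : hidden -> Q -> bool).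
Implicit Types (th : hidden).

Hypothesis p01 : 0 <= p <= 1.
Hypothesis M0 : (0 < M)%N.
Hypothesis act_inj : forall th th' a z, act th a z -> act th' a z -> th a = th' a.
Hypothesis won_act : forall th z, won th z -> act th ord_max z.
(** A query that misses all targets from l on gets an answer determined by the first l indices, and
    by index l too when the coin is up. *)
Hypothesis ans_local : forall l th th' (xi : bool) z,
  (forall a : 'I_n.+1, (a < l)%N -> th a = th' a) ->
  (forall a : 'I_n.+1, (l <= a)%N -> ~~ act th a z) ->
  (forall a : 'I_n.+1, (l <= a)%N -> ~~ act th' a z) ->
  (xi -> forall a : 'I_n.+1, (a < l.+1)%N -> th a = th' a) -> ans th xi z = ans th' xi z.

(* Probability that the query following m further answers is a winning one. *)
Fixpoint win_prob th (m k : nat) (h : k.-tuple Ob) : R :=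
  match m with
  | 0 => (won th (query k h))%:R
  | m'.+1 => p * win_prob th m' k.+1 [tuple of rcons h (ans th true (query k h))]
      + (1 - p) * win_prob th m' k.+1 [tuple of rcons h (ans th false (query k h))]
  end.

Lemma win_prob_ge0 th m k h : 0 <= win_prob th m k h.
Proof.
case/andP: p01 => p0 p1; elim: m k h => [|m IH] k h /=; first by rewrite ler0n.
by rewrite addr_ge0 // mulr_ge0 // subr_ge0.
Qed.

Lemma win_prob_le1 th m k h : win_prob th m k h <= 1.
Proof.
case/andP: p01 => p0 p1; elim: m k h => [|m IH] k h /=; first by case: won.
have := IH _ [tuple of rcons h (ans th true (query k h))].
have := IH _ [tuple of rcons h (ans th false (query k h))]; nra.
Qed.

(** By [act_inj] all hidden vectors for which z hits block a share their index there, so they lie in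
    one slice, a fraction 1 / M of the class. *)
Lemma card_act l th0 (a : 'I_n.+1) z : (l <= a)%N ->
  (#|[pred th | agreeb n M l th0 th & act th a z]|%:R <=
   #|[pred th | agreeb n M l th0 th]|%:R / M%:R :> R).
Proof.
move=> la; rewrite ler_pdivlMr ?ltr0n // -natrM ler_nat.
have [[th ath]|h] := pselect (exists th, act th a z); last first.
  rewrite eq_card0 ?mul0n // => th; rewrite !inE; apply/negP => /andP[_ ath].
  by apply: h; exists th.
rewrite -(card_agree_slice n M l th0 a (th a) la) leq_mul2r; apply/orP; right.
apply/subset_leq_card/fintype.subsetP => th'; rewrite !inE => /andP[-> h].
by rewrite (act_inj _ _ _ _ h ath) eqxx.
Qed.

(* The first summand bounds the expected number of indices revealed in the end,
   the second one is a union bound over accidental hits. *)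
Let rate m l : R := (l%:R + m%:R * p) / n.+1%:R + m.+1%:R * n.+1%:R / M%:R.

Let rate_ge m l : l%:R / n.+1%:R <= rate m l.
Proof.
case/andP: p01 => p0 p1.
rewrite /rate mulrDl -addrA lerDl addr_ge0 // !mulr_ge0 ?invr_ge0 ?ler0n //.
Qed.

(** Induction on the number of answers to come, over a class of hidden vectors with a common
    history. The vectors hit by the query are few; the others all receive the same answer when the
    coin is down, and are separated by index l at most when it is up. *)
Lemma sum_win_prob m l th0 k h : (l <= n.+1)%N ->
  \sum_(th | agreeb n M l th0 th) win_prob th m k h <=
  #|[pred th | agreeb n M l th0 th]|%:R * rate m l.
Proof.
case/andP: (p01) => p0 p1.
have M0' : 0 < M%:R :> R by rewrite ltr0n.
have T0 : 0 < n.+1%:R :> R by rewrite ltr0n.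
elim: m l th0 k h => [|m IH] l th0 k h; rewrite leq_eqVlt => /predU1P[ln|ln].
(* Once all n + 1 indices are known, the rate is at least 1 and the bound is trivial. *)
- apply: (@le_trans _ _ (\sum_(th | agreeb n M l th0 th) 1)).
    by apply: ler_sum => th _; exact: win_prob_le1.
  rewrite sumr_const ler_peMr ?ler0n //.
  by apply: le_trans (rate_ge _ _); rewrite ln divff // pnatr_eq0.
(* A win hits the last target, which is still unknown as l <= n, so 1 / M bounds its probability. *)
- apply: (@le_trans _ _ (#|[pred th | agreeb n M l th0 th & act th ord_max (query k h)]|%:R)).
    rewrite -sum1_card natr_sum.
    rewrite [leRHS]big_mkcondr /=; apply: ler_sum => th _.
    by case: (boolP (won th _)) => [/won_act ->|_] //; case: act.
  apply: le_trans (card_act _ _ _ _ _) _; first by rewrite -ltnS.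
  rewrite ler_wpM2l ?ler0n // /rate mul0r addr0 mul1r.
  rewrite -[leLHS]add0r lerD ?mulr_ge0 ?invr_ge0 ?ler0n //.
  by rewrite -[leLHS]mul1r ler_wpM2r ?invr_ge0 ?ler0n // ler1n.
- apply: (@le_trans _ _ (\sum_(th | agreeb n M l th0 th) 1)).
    by apply: ler_sum => th _; exact: win_prob_le1.
  rewrite sumr_const ler_peMr ?ler0n //.
  by apply: le_trans (rate_ge _ _); rewrite ln divff // pnatr_eq0.
set z := query k h; set C := [pred th | agreeb n M l th0 th].
pose leak th := [exists a : 'I_n.+1, (l <= a)%N && act th a z].
have noleak th : ~~ leak th -> forall a : 'I_n.+1, (l <= a)%N -> ~~ act th a z.
  by move=> /existsPn hn a la; have := hn a; rewrite la.
have hleak : \sum_(th | agreeb n M l th0 th && leak th) win_prob th m.+1 k h <=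
    #|C|%:R * (n.+1%:R / M%:R).
  apply: (@le_trans _ _ (\sum_(th | agreeb n M l th0 th)
     \sum_(a : 'I_n.+1 | (l <= a)%N) (act th a z)%:R)).
    rewrite big_mkcondr; apply: ler_sum => th _; case: ifPn => [/existsP[a /andP[la ha]]|_].
      apply: le_trans (win_prob_le1 _ _ _ _) _.
      by rewrite (bigD1 a) //= ha lerDl sumr_ge0.
    by rewrite sumr_ge0.
  rewrite exchange_big /=.
  apply: (@le_trans _ _ (\sum_(a : 'I_n.+1 | (l <= a)%N) (#|C|%:R / M%:R))).
    apply: ler_sum => a la; apply: le_trans (card_act l th0 a z la).
    rewrite -sum1_card natr_sum [leRHS]big_mkcondr /=.
    by apply: ler_sum => th _; case: act.
  rewrite big_mkcond (_ : #|C|%:R * (_ / _) = \sum_(a < n.+1) #|C|%:R / M%:R).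
    by apply: ler_sum => a _; case: ifP => // _; rewrite mulr_ge0 ?invr_ge0.
  by rewrite sumr_const card_ord -[RHS]mulr_natr mulrAC mulrA.
have h0 : \sum_(th | agreeb n M l th0 th && ~~ leak th)
    win_prob th m k.+1 [tuple of rcons h (ans th false z)] <= #|C|%:R * rate m l.
  apply: (sum_common_le _ _ _ (agreeb n M l th0) (fun th => ans th false z)
    (fun th v => win_prob th m k.+1 [tuple of rcons h v])).
  - by move=> th /andP[].
  - move=> th th' /andP[/agreebP ag /noleak nl] /andP[/agreebP ag' /noleak nl'].
    by apply: (ans_local l) => // a al; rewrite -ag // ag'.
  - by move=> th v; exact: win_prob_ge0.
  - rewrite mulr_ge0 // (le_trans _ (rate_ge m l)) // mulr_ge0 ?invr_ge0 ?ler0n //.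
  - by move=> v; apply: IH; exact: ltnW.
pose j : 'I_n.+1 := Ordinal ln.
(* With the coin up, the class is cut by the value of index l, and the induction hypothesis at l + 1
   applies to each piece. *)
have h1 : \sum_(th | agreeb n M l th0 th && ~~ leak th)
    win_prob th m k.+1 [tuple of rcons h (ans th true z)] <= #|C|%:R * rate m l.+1.
  rewrite (partition_big (fun th => th j) xpredT) //=.
  apply: (@le_trans _ _ (\sum_(i < M)
      #|[pred th | agreeb n M l.+1 (set_hidden n M th0 j i) th]|%:R * rate m l.+1)).
    apply: ler_sum => i _.
    apply: (sum_common_le _ _ _ (agreeb n M l.+1 (set_hidden n M th0 j i))
      (fun th => ans th true z) (fun th v => win_prob th m k.+1 [tuple of rcons h v])).
    - by move=> th /andP[/andP[ag _] hj]; rewrite agreeb_succ // ag.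
    - move=> th th' /andP[/andP[/agreebP ag /noleak nl] /eqP hj].
      move=> /andP[/andP[/agreebP ag' /noleak nl'] /eqP hj'].
      have agl (a : 'I_n.+1) : (a < l)%N -> th a = th' a by move=> al; rewrite -ag // ag'.
      apply: (ans_local l) => // _ a; rewrite ltnS leq_eqVlt => /predU1P[al|/agl //].
      by rewrite (_ : a = j) ?hj //; exact/val_inj.
    - by move=> th v; exact: win_prob_ge0.
    - rewrite mulr_ge0 // (le_trans _ (rate_ge m l.+1)) // mulr_ge0 ?invr_ge0 ?ler0n //.
    - by move=> v; exact: IH.
  rewrite -mulr_suml ler_wpM2r //.
    by rewrite (le_trans _ (rate_ge m l.+1)) // mulr_ge0 ?invr_ge0 ?ler0n.
  rewrite -natr_sum ler_nat -[leqRHS]sum1_card.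
  rewrite [leqRHS](partition_big (fun th => th j) xpredT) //=.
  apply: leq_sum => i _; rewrite -sum1_card leq_eqVlt; apply/orP; left; apply/eqP.
  by apply: eq_bigl => th; rewrite !inE agreeb_succ.
have h2 : \sum_(th | agreeb n M l th0 th && ~~ leak th) win_prob th m.+1 k h <=
    p * (#|C|%:R * rate m l.+1) + (1 - p) * (#|C|%:R * rate m l).
  rewrite /= big_split /= -!mulr_sumr.
  by apply: lerD; apply: ler_wpM2l => //; rewrite subr_ge0.
rewrite (bigID leak); apply: le_trans (lerD hleak h2) _.
rewrite le_eqVlt; apply/predU1P; left.
(* The rate solves this recurrence exactly: (n + 1) / M for the present query, then l + 1 known
   indices with probability p and l otherwise. *)
rewrite /rate -[m.+2%:R]natr1 -[m.+1%:R]natr1 -[l.+1%:R]natr1; field.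
by rewrite !lt0r_neq0.
Qed.

Lemma sum_win_prob_all m h : (0 < #|{: hidden}|)%N ->
  \sum_th win_prob th m 0 h <=
  #|{: hidden}|%:R * (m%:R * p / n.+1%:R + m.+1%:R * n.+1%:R / M%:R).
Proof.
move=> /card_gt0P[th0 _].
have ag th : agreeb n M 0 th0 th by apply/agreebP.
have := sum_win_prob m 0 th0 0 h isT; rewrite /rate add0r.
rewrite (eq_bigl xpredT) // => /le_trans; apply.
by rewrite le_eqVlt; apply/predU1P; left; congr (_%:R * _); apply: eq_card => th; rewrite !inE ag.
Qed.

End Game.

(** * The lower bound *)

Section ScaledInstance.
Context {R : realType} (n M : nat) (p al be mu : R).
Local Notation d := (n.+1 * M)%N.
Local Notation N := (d + 1)%N.
Local Notation hidden := {ffun 'I_n.+1 -> 'I_M}.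
Hypotheses (p0 : 0 < p) (p1 : p <= 1) (al0 : 0 < al) (be0 : 0 < be) (M0 : (0 < M)%N).
Implicit Types th : hidden.

Definition scaled_obj th (x : 'rV[R]_d) : R := al * chain n M th (be *: x).
Definition scaled_grad th (x : 'rV[R]_d) : 'rV[R]_d := (al * be) *: dchain n M th (be *: x).
Definition upper th (z : 'rV[R]_N) : R := scaled_obj th (lsubmx z).
Definition lower (z : 'rV[R]_N) : R := mu / 2 * enorm (rsubmx z) ^+ 2.
Definition upper_oracle th (z : 'rV[R]_N) (xi : bool) : 'rV[R]_N :=
  row_mx ((al * be) *: ochain n M p th xi (be *: lsubmx z)) 0.
(** Exact, and the same for all hidden vectors, so it discloses nothing. *)
Definition lower_oracle (z : 'rV[R]_N) (xi : bool) : 'rV[R]_N := row_mx 0 (mu *: rsubmx z).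

Let p01 : 0 <= p <= 1. Proof. by rewrite ltW. Qed.

Lemma hasgrad_scaled_obj th x : hasgrad d (scaled_obj th) x (scaled_grad th x).
Proof.
have h : hasgrad d (chain n M th) (be *: x + 0) (dchain n M th (be *: x)).
  by rewrite addr0; exact: hasgrad_chain.
pose sc : {linear 'rV[R]_d -> 'rV[R]_d} := *:%R be.
have h2 : hasgrad d (fun y => chain n M th (sc y + 0)) x (be *: dchain n M th (be *: x)).
  by apply: (hasgrad_affine _ _ sc 0 _ _ _ _ h) => v; rewrite dotpZl dotpZr.
have := hasgradZ _ al _ _ _ h2; rewrite scalerA.
rewrite (_ : (fun y => _) = scaled_obj th) //.
by apply/funext => y; rewrite addr0.
Qed.

Lemma scaled_grad_lip th x y :
  enorm (scaled_grad th x - scaled_grad th y) <= al * be ^+ 2 * (3 * 4 ^+ 6) * enorm (x - y).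
Proof.
rewrite -scalerBr enormZ gtr0_norm ?mulr_gt0 //.
have := dchain_lip n M th (be *: x) (be *: y).
rewrite -scalerBr enormZ (gtr0_norm be0) => h.
rewrite (_ : al * _ * _ * _ = al * be * (3 * 4 ^+ 6 * (be * enorm (x - y)))).
  by rewrite ler_wpM2l // ltW // mulr_gt0.
by rewrite expr2; move: (3 * 4 ^+ 6 : R) (enorm _) => u v; ring.
Qed.

Lemma scaled_obj_gap th x : scaled_obj th 0 - scaled_obj th x <= al * (4 ^+ 4 * n.+1%:R).
Proof. by rewrite /scaled_obj -mulrBr scaler0 ler_wpM2l ?chain_gap // ltW. Qed.

Lemma scaled_grad_ge th x : ~~ captured n M th (be *: x) -> al * be <= enorm (scaled_grad th x).
Proof.
move=> /dchain_ge1 h; rewrite enormZ gtr0_norm ?mulr_gt0 //.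
by rewrite ler_peMr // ltW // mulr_gt0.
Qed.

Lemma upper_oracleP th sigma : (al * be) ^+ 2 * 4 ^+ 11 * ((1 - p) / p) <= sigma ^+ 2 ->
  sgrad_oracle (bernoulli_prob p) (upper th) (upper_oracle th) sigma.
Proof.
move=> hs z; have gE : grad (upper th) z = row_mx (scaled_grad th (lsubmx z)) 0.
  exact: (grad_lsubmx _ _ _ _ (hasgrad_scaled_obj th)).
split=> [i|].
  split; first exact: bernoulli_integrable.
  rewrite (integral_bernoulli_EFin p p01 (fun b => upper_oracle th z b 0 i)) gE; congr EFin.
  have <- : p *: upper_oracle th z true + (1 - p) *: upper_oracle th z false =
      row_mx (scaled_grad th (lsubmx z)) 0.
    rewrite /upper_oracle !scale_row_mx !scaler0 add_row_mx addr0 /scaled_grad.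
    rewrite -(ochain_mean n M p) ?gt_eqF // scalerDr !scalerA.
    by rewrite ![_ * (al * be)]mulrC.
  by rewrite [RHS]mxE [X in _ = X + _]mxE [X in _ = _ + X]mxE.
rewrite (integral_bernoulli_EFin p p01 (fun b => enorm (upper_oracle th z b - _) ^+ 2)).
rewrite lee_fin; apply: le_trans hs.
have step b : enorm (upper_oracle th z b - grad (upper th) z) ^+ 2 <=
    (al * be) ^+ 2 * 4 ^+ 11 * (b%:R / p - 1) ^+ 2.
  rewrite gE /upper_oracle /scaled_grad opp_row_mx add_row_mx subr0 enorm_row_mx0 -scalerBr.
  rewrite enormZ exprMn real_normK ?num_real // -mulrA ler_wpM2l ?sqr_ge0 //.
  exact: ochain_var.
have q0 : 0 <= 1 - p by rewrite subr_ge0.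
(* The variance of xi / p is p (1/p - 1)^2 + (1 - p) = (1 - p) / p. *)
apply: le_trans (lerD (ler_wpM2l (ltW p0) (step true)) (ler_wpM2l q0 (step false))) _.
rewrite le_eqVlt; apply/predU1P; left; rewrite mulr1n mulr0n.
by move: ((al * be) ^+ 2 * 4 ^+ 11) => c; field; rewrite gt_eqF.
Qed.

Lemma lower_oracleP sigma : sgrad_oracle (bernoulli_prob p) lower lower_oracle sigma.
Proof.
move=> z; have gE : grad lower z = row_mx 0 (mu *: rsubmx z) := grad_quad _ _ mu z.
split=> [i|].
  split; first exact: bernoulli_integrable.
  rewrite (integral_bernoulli_EFin p p01 (fun b => lower_oracle z b 0 i)) gE; congr EFin.
  by rewrite /lower_oracle -mulrDl addrC subrK mul1r.
rewrite (integral_bernoulli_EFin p p01 (fun b => enorm (lower_oracle z b - _) ^+ 2)).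
by rewrite gE /lower_oracle subrr enorm0 expr0n !mulr0 addr0 lee_fin sqr_ge0.
Qed.

(** * Expected gradient norm along a run *)

Section Run.
Context ds (S : measurableType ds) (A : algo R d 1 S).
Hypothesis mA : forall t, measurable_fun setT (A t).
Local Notation Q := (Pt R d 1).
Local Notation Ob := (Obs R d 1).
Local Notation EVth th := (EV (bernoulli_prob p) (upper th) lower (upper_oracle th) lower_oracle A).

Definition answer th (xi : bool) (z : Q) : Ob :=
  (r2t (upper_oracle th (row_of_pt z) xi), r2t (lower_oracle (row_of_pt z) xi)).

Lemma EV_ge0 th r m k (h : k.-tuple Ob) : (0 <= EVth th r m h)%E.
Proof.
elim: m k h => [|m IH] k h /=; first by rewrite lee_fin enorm_ge0.
exact: integral_ge0.
Qed.

Lemma EV_S th r m k (h : k.-tuple Ob) : EVth th r m.+1 h =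
  (p%:E * EVth th r m [tuple of rcons h (answer th true (pt_at A r h))] +
   (1 - p)%:E * EVth th r m [tuple of rcons h (answer th false (pt_at A r h))])%E.
Proof.
rewrite /= (integral_bernoulli_prob p01) // => b; exact: EV_ge0.
Qed.

Lemma phi_upper th : phi (upper th) lower = scaled_obj th.
Proof. exact: phi_lsubmx. Qed.

Lemma measurable_pt_at k :
  measurable_fun setT (fun rh : S * k.-tuple Ob => pt_at A rh.1 rh.2).
Proof.
case: k => [|k] /=; first exact: measurable_cst.
rewrite (_ : (fun rh => _) = A k) //; by apply/funext => -[].
Qed.

Lemma measurable_answer th xi : measurable_fun setT (answer th xi).
Proof.
have m1 : measurable_row _ _ _ (fun z : Q => t2r z.1) by exact: measurable_row_t2r.
have m2 : measurable_row _ _ _ (fun z : Q => t2r z.2) by exact: measurable_row_t2r.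
apply: measurable_fun_pair; apply: measurable_row_r2t.
  apply: measurable_row_row_mx; last exact: measurable_row_cst.
  apply: measurable_rowZ; first exact: measurable_cst.
  apply: measurable_row_ochain; under eq_fun do rewrite /row_of_pt row_mxKl.
  by apply: measurable_rowZ; first exact: measurable_cst.
apply: measurable_row_row_mx; first exact: measurable_row_cst.
apply: measurable_rowZ; first exact: measurable_cst.
by under eq_fun do rewrite /row_of_pt row_mxKr.
Qed.

(** Seed and history are taken jointly, since the next query depends on both; this lets the
    induction pass through the maps of the algorithm. *)
Lemma measurable_EV th m k :
  measurable_fun setT (fun rh : S * k.-tuple Ob => EVth th rh.1 m rh.2).
Proof.
elim: m k => [|m IH] k.
  apply/measurable_EFinP; rewrite phi_upper.
  under eq_fun do rewrite (hasgrad_grad _ _ _ _ (hasgrad_scaled_obj th _)).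
  apply: measurable_enorm; apply: measurable_rowZ; first exact: measurable_cst.
  apply: measurable_row_dchain; apply: measurable_rowZ; first exact: measurable_cst.
  apply: measurable_row_t2r; apply: measurableT_comp => //; exact: measurable_pt_at.
under eq_fun do rewrite EV_S.
have step xi : measurable_fun setT (fun rh : S * k.-tuple Ob =>
    EVth th rh.1 m [tuple of rcons rh.2 (answer th xi (pt_at A rh.1 rh.2))]).
  pose ext (rh : S * k.-tuple Ob) : S * k.+1.-tuple Ob :=
    (rh.1, [tuple of rcons rh.2 (answer th xi (pt_at A rh.1 rh.2))]).
  apply: (measurableT_comp (IH k.+1) (g := ext)).
  apply: measurable_fun_pair => //; apply: measurable_rcons => //.
  by apply: measurableT_comp; [exact: measurable_answer|exact: measurable_pt_at].
by apply: emeasurable_funD; apply: measurable_funeM.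
Qed.

Local Notation won := (fun th (z : Q) => captured n M th (be *: t2r z.1)).
Local Notation win r := (win_prob n M Q Ob p (@pt_at R d 1 S A r) answer won).

(** Both sides satisfy the same recursion over the coin, so it suffices to compare the final query:
    its gradient is at least [al * be] unless it wins. *)
Lemma EV_ge th r m k (h : k.-tuple Ob) :
  ((al * be * (1 - win r th m k h))%:E <= EVth th r m h)%E.
Proof.
have ab0 : 0 < al * be by rewrite mulr_gt0.
elim: m k h => [|m IH] k h.
  rewrite /= phi_upper (hasgrad_grad _ _ _ _ (hasgrad_scaled_obj th _)) lee_fin.
  case: (boolP (captured _ _ _ _)) => [_|/scaled_grad_ge h'].
    by rewrite subrr mulr0 enorm_ge0.
  by rewrite subr0 mulr1.
rewrite EV_S /=.
set w1 := win_prob _ _ _ _ _ _ _ _ _ _ _ _; set w0 := win_prob _ _ _ _ _ _ _ _ _ _ _ _.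
rewrite (_ : al * be * _ = p * (al * be * (1 - w1)) + (1 - p) * (al * be * (1 - w0))); last by ring.
rewrite EFinD !EFinM; apply: leeD.
  by apply: lee_wpmul2l; [rewrite lee_fin ltW|exact: IH].
by apply: lee_wpmul2l; [rewrite lee_fin subr_ge0|exact: IH].
Qed.

Let act th (a : 'I_n.+1) (z : Q) := active n M th a (be *: t2r z.1).

Lemma sum_win r m : (0 < #|{: hidden}|)%N ->
  \sum_th win r th m 0 [tuple] <=
  #|{: hidden}|%:R * (m%:R * p / n.+1%:R + m.+1%:R * n.+1%:R / M%:R).
Proof.
have act_inj th th' a z : act th a z -> act th' a z -> th a = th' a := active_inj n M th th' a _.
have won_act th z : won th z -> act th ord_max z.
  move=> /forallP/(_ ord_max); rewrite /act /active.
  move: (enorm_ge0 _ (offset n M th ord_max (be *: t2r z.1))); move: (enorm _) => u; nra.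
have ans_local l th th' (xi : bool) z : (forall a : 'I_n.+1, (a < l)%N -> th a = th' a) ->
    (forall a : 'I_n.+1, (l <= a)%N -> ~~ act th a z) ->
    (forall a : 'I_n.+1, (l <= a)%N -> ~~ act th' a z) ->
    (xi -> forall a : 'I_n.+1, (a < l.+1)%N -> th a = th' a) ->
    answer th xi z = answer th' xi z.
  move=> ag nl nl' agx.
  have e : ochain n M p th xi (be *: t2r z.1) = ochain n M p th' xi (be *: t2r z.1).
    exact: (ochain_local n M p l th th' xi _ ag nl nl' agx).
  by rewrite /answer /upper_oracle /row_of_pt row_mxKl e.
exact: (sum_win_prob_all n M Q Ob p (@pt_at R d 1 S A r) answer act won p01 M0
  act_inj won_act ans_local m [tuple]).
Qed.

End Run.

Lemma expected_grad_ge ds (S : measurableType ds) (Ps : probability S R) (A : algo R d 1 S)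
    (th0 : hidden) (mA : forall t, measurable_fun setT (A t)) (t : nat) :
  t%:R * p / n.+1%:R + t.+1%:R * n.+1%:R / M%:R <= 1 ->
  ((al * be * (1 - (t%:R * p / n.+1%:R + t.+1%:R * n.+1%:R / M%:R)))%:E <=
   \int[unif_nat #|{: hidden}|.-1]_i \int[Ps]_r
     EV (bernoulli_prob p) (upper (nth th0 (enum {: hidden}) i)) lower
       (upper_oracle (nth th0 (enum {: hidden}) i)) lower_oracle A r t [tuple])%E.
Proof.
pose rate : R := t%:R * p / n.+1%:R + t.+1%:R * n.+1%:R / M%:R.
rewrite -/rate => rate1; pose K := #|{: hidden}|.
have K0 : (0 < K)%N by apply/card_gt0P; exists th0.
have ab0 : 0 < al * be by rewrite mulr_gt0.
pose E (i : nat) (r : S) := EV (bernoulli_prob p) (upper (nth th0 (enum {: hidden}) i)) lower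
       (upper_oracle (nth th0 (enum {: hidden}) i)) lower_oracle A r t [tuple].
have E0 i r : (0 <= E i r)%E by exact: EV_ge0.
have mE i : measurable_fun setT (E i).
  pose g (r : S) : S * 0.-tuple (Obs R d 1) := (r, [tuple]).
  have mg : measurable_fun setT g.
    by apply: measurable_fun_pair; [exact: measurable_id|exact: measurable_cst].
  have := (measurableT_comp (measurable_EV ds S A mA (nth th0 (enum {: hidden}) i) t 0) mg); exact.
rewrite integral_unif_nat; last by move=> i; apply: integral_ge0 => r _; exact: E0.
rewrite prednK //.
(* The average over hidden vectors is moved inside the expectation over the seed: for a fixed seed
   the algorithm is deterministic and [sum_win] applies. *)
rewrite -(@ge0_integral_sum _ _ _ Ps setT measurableT _ (fun i : 'I_K => E i)) //; last first.
have low r : ((al * be * (K%:R * (1 - rate)))%:E <= \sum_(i < K) E i r)%E.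
  apply: (@le_trans _ _ (\sum_(i < K) (al * be * (1 - win_prob n M _ _ p
     (@pt_at R d 1 S A r) answer (fun th z => captured n M th (be *: t2r z.1))
     (nth th0 (enum {: hidden}) i) t 0 [tuple]))%:E)%E); last first.
    by apply: lee_sum => i _; exact: EV_ge.
  rewrite sumEFin lee_fin -mulr_sumr; apply: ler_wpM2l; first exact: ltW.
  rewrite sumrB sumr_const card_ord mulrBr mulr1 lerD2l lerN2.
  apply: le_trans (sum_win ds S A r t K0); rewrite le_eqVlt; apply/predU1P; left.
  rewrite -(big_mkord xpredT (fun i => win_prob _ _ _ _ _ _ _ _ (nth th0 _ i) t 0 _)).
  by rewrite /K cardE -(big_nth th0 xpredT (fun th => win_prob _ _ _ _ _ _ _ _ th t 0 _)) big_enum.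
have -> : (al * be * (1 - rate))%:E =
    ((K%:R^-1)%:E * \int[Ps]_r (cst (al * be * (K%:R * (1 - rate)))%:E r))%E.
  rewrite integral_cst //.
  rewrite [X in (_ * (_ * X))%E](_ : _ = 1%E); last exact: probability_setT.
  rewrite mule1 -EFinM; congr EFin.
  by field; rewrite pnatr_eq0 -lt0n.
apply: lee_wpmul2l; first by rewrite lee_fin invr_ge0.
apply: ge0_le_integral => //.
- by move=> r _; rewrite lee_fin !mulr_ge0 ?(ltW al0) ?(ltW be0) ?ler0n ?subr_ge0.
- by apply: emeasurable_sum => i.
Qed.

End ScaledInstance.

(** Here [ell], [G] and [V] are the smoothness, the gap per link and the variance constant of the
    unscaled instance. The first two equations determine [al] and [be]; the gap then limits the
    number of links, the variance bounds p from below, and M only has to be large. *)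
Lemma parameter_choice {R : realType} (ell G V : R) : 0 < ell -> 0 < G -> 0 < V ->
  exists c c' : R, 0 < c /\ 0 < c' /\
  forall Delta L sigma eps : R, 0 < Delta -> 0 < L -> 0 < sigma -> 0 < eps ->
  eps <= c * Num.sqrt (L * Delta) ->
  exists (n M : nat) (p al be : R),
    [/\ [/\ (0 < M)%N, 0 < p, p <= 1, 0 < al & 0 < be],
        al * be = 2 * eps, al * be ^+ 2 * ell = L, al * (G * n.+1%:R) <= Delta &
        (al * be) ^+ 2 * V * ((1 - p) / p) <= sigma ^+ 2 /\
        forall t : nat, t%:R < c' * Delta * L * sigma ^+ 2 / eps ^+ 4 ->
          t%:R * p / n.+1%:R + t.+1%:R * n.+1%:R / M%:R <= 3 / 8].
Proof.
move=> ell0 G0 V0; pose u := 4 * ell * G.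
have u0 : 0 < u by rewrite !mulr_gt0.
(* The first constant ensures X >= 1, so that at least one link fits; the second makes Y * w = X / 8
   below. *)
exists (u + 1)^-1, (32 * V * u)^-1.
have c0 : 0 < (u + 1)^-1 by rewrite invr_gt0 addr_gt0.
have c'0 : 0 < (32 * V * u)^-1 by rewrite invr_gt0 !mulr_gt0.
split=> //; split=> // Delta L sigma eps D0 L0 s0 e0 he.
have s20 : 0 < sigma ^+ 2 by rewrite exprn_gt0.
have e20 : 0 < eps ^+ 2 by rewrite exprn_gt0.
pose X := Delta * L / (u * eps ^+ 2).
have X1 : 1 <= X.
  rewrite /X ler_pdivlMr ?mulr_gt0 // mul1r.
  have DL : 0 <= L * Delta by rewrite mulr_ge0 // ltW.
  have he2 : eps ^+ 2 <= (u + 1)^-1 ^+ 2 * (L * Delta).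
    rewrite -[L * Delta](sqr_sqrtr DL) -exprMn.
    by rewrite lerXn2r ?nnegrE ?mulr_ge0 ?sqrtr_ge0 ?(ltW e0) ?(ltW c0).
  have cu : u * (u + 1)^-1 ^+ 2 <= 1.
    by rewrite exprVn ler_pdivrMr ?exprn_gt0 ?addr_gt0 //; nra.
  have h1 := ler_wpM2l (ltW u0) he2; have h2 := ler_wpM2r DL cu.
  by rewrite mulrA in h1; rewrite (mulrC Delta); lra.
have X0 : 0 < X by lra.
(* The number of links is the integer part of X, hence at least X / 2. *)
have [n nX] : exists n : nat, n.+1%:R <= X < n.+2%:R.
  have tX := truncn_itv (ltW X0); exists (Num.truncn X).-1; rewrite prednK //.
  by rewrite truncn_gt0.
case/andP: nX => nX Xn.
have T0 : 0 < n.+1%:R :> R by rewrite ltr0n.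
have TX : X / 2 <= n.+1%:R.
  move: Xn; rewrite -[n.+2%:R]natr1; have : 1 <= n.+1%:R :> R by rewrite ler1n.
  lra.
pose Y := (32 * V * u)^-1 * Delta * L * sigma ^+ 2 / eps ^+ 4.
have Y0 : 0 < Y by rewrite /Y !mulr_gt0 // ?invr_gt0 exprn_gt0.
(* Large enough to keep the union bound below 1/8 for all t < Y. *)
pose M := (Num.truncn (8 * (Y + 1) * n.+1%:R)).+1.
have HM : 8 * (Y + 1) * n.+1%:R < M%:R by exact: truncnS_gt.
have M0 : 0 < M%:R :> R by rewrite ltr0n.
(* The value of p at which (2 eps)^2 V / p equals sigma^2. When it exceeds 1, p = 1 and the variance
   bound is 0. *)
pose w := 4 * eps ^+ 2 * V / sigma ^+ 2.
have w0 : 0 < w by rewrite /w !mulr_gt0 ?invr_gt0.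
pose p := Num.min 1 w.
have p0 : 0 < p by rewrite /p lt_min ltr01.
have pw : p <= w by rewrite /p ge_min lexx orbT.
have p1 : p <= 1 by rewrite /p ge_min lexx.
pose be := L / (2 * eps * ell); pose al := 4 * eps ^+ 2 * ell / L.
have be0 : 0 < be by rewrite /be !mulr_gt0 ?invr_gt0 ?mulr_gt0.
have al0 : 0 < al by rewrite /al !mulr_gt0 ?invr_gt0.
have [[nL ne nell nu nV] ns] : [/\ L != 0, eps != 0, ell != 0, u != 0 & V != 0] /\ sigma != 0.
  by rewrite !gt_eqF.
have ab : al * be = 2 * eps by rewrite /al /be; field; rewrite ne nL nell.
exists n, M, p, al, be; split=> //.
- by rewrite /al /be; field; rewrite ne nL nell.
- have <- : al * (G * X) = Delta.
    rewrite /al /X /u; field.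
    by rewrite ne nL nell gt_eqF.
  by rewrite ler_wpM2l ?(ltW al0) // ler_wpM2l // ltW.
split.
  rewrite ab; have [w1|w1] := leP 1 w.
    rewrite /p (min_idPl w1) subrr mul0r mulr0 ltW //.
  have -> : p = w by apply/min_idPr/ltW.
  have nw : w != 0 by rewrite gt_eqF.
  have -> : (2 * eps) ^+ 2 * V = sigma ^+ 2 * w by rewrite /w; field.
  have -> : sigma ^+ 2 * w * ((1 - w) / w) = sigma ^+ 2 * (1 - w) by field.
  by rewrite ler_piMr ?(ltW s20) // gerBl ltW.
move=> t; rewrite -/Y => tY.
have h1 : t%:R * p / n.+1%:R <= 4^-1.
  rewrite ler_pdivrMr //; apply: (@le_trans _ _ (Y * w)).
    by rewrite ler_pM ?ler0n // ltW.
  have -> : Y * w = X / 8.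
    by rewrite /Y /w /X; field; rewrite ne nV nu ns.
  lra.
have h2 : t.+1%:R * n.+1%:R / M%:R <= 8^-1 :> R.
  rewrite (ler_pdivrMr _ _ M0) -natr1; have : t%:R * n.+1%:R <= Y * n.+1%:R :> R.
    by rewrite ler_wpM2r // ltW.
  lra.
apply: le_trans (lerD h1 h2) _; lra.
Qed.

Theorem theorem4p1 (R : realType) :
  exists c c' : R, 0 < c /\ 0 < c' /\
  forall (p : nat) (Delta : R) (L : nat -> R) (mu sigma eps : R),
    (0 < p)%N -> 0 < Delta -> (forall i, (i <= p.+1)%N -> 0 < L i) ->
    0 < mu -> mu <= L 1%N -> 0 < sigma -> 0 < eps ->
    eps <= c * Num.sqrt (L 1%N * Delta) ->
    exists (dx dy : nat)
      (dth : measure_display) (Th : measurableType dth) (Pth : probability Th R)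
      (f g : Th -> 'rV[R]_(dx + dy) -> R)
      (dxi : measure_display) (Xi : measurableType dxi) (Pxi : probability Xi R)
      (Fo Go : Th -> 'rV[R]_(dx + dy) -> Xi -> 'rV[R]_(dx + dy)),
      (forall th, in_class p L mu Delta (f th) (g th)) /\
      (forall th, sgrad_oracle Pxi (f th) (Fo th) sigma /\
                  sgrad_oracle Pxi (g th) (Go th) sigma) /\
      forall (ds : measure_display) (S : measurableType ds) (Ps : probability S R)
             (A : algo R dx dy S),
        (forall t, measurable_fun setT (A t)) ->
        forall t : nat, t%:R < c' * Delta * L 1%N * sigma ^+ 2 / eps ^+ 4 ->
          (eps%:E < \int[Pth]_th \int[Ps]_r
                      EV Pxi (f th) (g th) (Fo th) (Go th) A r t [tuple])%E.
Proof.
(* The arguments are the constants of [dchain_lip], [chain_gap] and [ochain_var]. *)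
have [||| c [c' [c0 [c'0 choice]]]] := @parameter_choice R (3 * 4 ^+ 6) (4 ^+ 4) (4 ^+ 11).
- by rewrite mulr_gt0 // exprn_gt0.
- exact: exprn_gt0.
- exact: exprn_gt0.
exists c, c'; split=> //; split=> // q Delta L mu sigma eps q0 D0 Lpos mu0 muL s0 e0 he.
have L1 : 0 < L 1%N by exact: Lpos.
have [n [M [p [al [be [[M0 p0 p1 al0 be0] ab lip gap [var rate]]]]]]] :=
  choice _ _ _ _ D0 L1 s0 e0 he.
pose th0 : {ffun 'I_n.+1 -> 'I_M} := [ffun=> Ordinal M0].
(* [th0] is the default beyond the end of the enumeration; the uniform measure gives those positions
   no mass. *)
pose th (i : nat) := nth th0 (enum {: {ffun 'I_n.+1 -> 'I_M}}) i.
exists (n.+1 * M)%N, 1%N, _, nat, (unif_nat #|{: {ffun 'I_n.+1 -> 'I_M}}|.-1).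
exists (fun i => upper n M al be (th i)), (fun=> lower n M mu).
exists _, bool, (bernoulli_prob p).
exists (fun i => upper_oracle n M p al be (th i)), (fun=> lower_oracle n M mu).
split; last split.
- move=> i; apply: (in_class_lsubmx _ _ _ _ _ _ _ (scaled_grad n M al be (th i))) => //.
  + exact: hasgrad_scaled_obj.
  + by move=> x y; rewrite -lip; exact: scaled_grad_lip.
  + by move=> x; apply: le_trans gap; exact: scaled_obj_gap.
- by move=> i; split; [exact: upper_oracleP|exact: lower_oracleP].
move=> ds S Ps A mA t /rate ht.
(* The rate is at most 3/8, so the expected norm is at least 2 eps * 5/8 = 5/4 eps. *)
apply: lt_le_trans (expected_grad_ge n M p al be mu p0 p1 al0 be0 M0 ds S Ps A th0 mA t _).
  have e2 : 0 <= 2 * eps by lra.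
  rewrite lte_fin ab; move: ht; move: (_ + _ / M%:R) => r ht.
  have := ler_wpM2l e2 ht; lra.
by apply: le_trans ht _; lra.
Qed.
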